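(* Suppose that $n^{-2/3}\ll p\ll n^{-1/2}$ and $q\gg n^{-3}p^{-7/2}$, and let $G_1\sim G_{n,p}$ and $G_2\sim G_{n,q}$ be independent. Then a.a.s. no $G_1$-measurable colouring $\varphi\colon E(G_1)\to\{\mathrm{red},\mathrm{blue}\}$ without monochromatic triangles can be extended to a colouring of $E(G_1\cup G_2)$ without monochromatic triangles.
   Context: $G_{n,p}$ is the binomial random graph on $[n]$ with edge probability $p$. A.a.s. means with probability tending to $1$ as $n\to\infty$. $f\ll g$ (equivalently $g\gg f$) means $f/g\to 0$. A colouring of $G_1$ is $G_1$-measurable if it is a function of $G_1$ alone (chosen without knowledge of $G_2$). Extending $\varphi$ means colouring $E(G_1\cup G_2)$ so that the colouring agrees with $\varphi$ on $E(G_1)$. *)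

(* Defs.v *)
From HB Require Import structures.
From mathcomp Require Import all_boot all_order all_algebra.
From mathcomp Require Import all_classical all_reals all_analysis.
Set Implicit Arguments.
Unset Strict Implicit.
Unset Printing Implicit Defensive.
Import Order.TTheory GRing.Theory Num.Theory.
Import numFieldNormedType.Exports.
Local Open Scope classical_set_scope.
Local Open Scope ring_scope.

Definition edge (n : nat) : finType := {e : {set 'I_n} | #|e| == 2%N}.

Definition graph (n : nat) : finType := {set edge n}.

(* The two colours red and blue are true and false. A colouring is given on all
   pairs of vertices, but is only ever consulted on the edges of the graph that
   is being coloured. *)
Definition colouring (n : nat) : finType := {ffun edge n -> bool}.

(* The triangles of the complete graph are the 3-sets T of vertices; the edges
   of T are the pairs contained in T. *)
Definition mono_triangle (n : nat) (G : graph n) (c : colouring n)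
    (T : {set 'I_n}) : bool :=
  (#|T| == 3%N) &&
  [exists b : bool,
     [forall e : edge n, (val e \subset T) ==> (e \in G) && (c e == b)]].

Definition no_mono_triangle (n : nat) (G : graph n) (c : colouring n) : bool :=
  [forall T : {set 'I_n}, ~~ mono_triangle G c T].

Definition extendable (n : nat) (G1 G2 : graph n) (c : colouring n) : bool :=
  [exists d : colouring n,
     [forall e in G1, d e == c e] && no_mono_triangle (G1 :|: G2) d].

Definition gnp {R : realType} (n : nat) (p : R) (G : graph n) : R :=
  \prod_(e : edge n) (if e \in G then p else 1 - p).

(* Probability of A G1 G2 for independent G1 ~ G_{n,p} and G2 ~ G_{n,q}. *)
Definition gnp2_pr {R : realType} (n : nat) (p q : R)
    (A : graph n -> graph n -> bool) : R :=
  \sum_(G1 : graph n) \sum_(G2 : graph n | A G1 G2) gnp p G1 * gnp q G2.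

(* f << g. Since x / 0 = 0, the convergence of f / g to 0 must be accompanied by
   the requirement that the quotient is eventually meaningful. *)
Definition much_less {R : realType} (f g : nat -> R) : Prop :=
  (\forall n \near \oo, g n != 0) /\ (f n / g n @[n --> \oo] --> (0 : R)).

(* Main.v *)
(* Idea.  Fix a colouring of G_1 without monochromatic triangles.  Consider
   sextuples x, y, t, a, b, z such that xyt is a triangle of G_1, the paths x-a-z
   and y-b-z lie in one colour class D, and the edge xy of G_1 is not in D.  If
   both xz and yz appear in G_2, then an extension has to give them the colour
   opposite to D, and xyz is monochromatic.  A.a.s. every colouring produces
   Omega(n^6 p^7) such sextuples; since n^6 p^7 q^2 -> oo, the second moment method
   over G_2 finishes the proof.

   To find the sextuples, split the vertices into classes X_0, X_1, X_2 and A_0.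
   A vertex of A_0 has the same majority colour towards two of the X_i; by
   pigeonhole, there are X = X_i, Z = X_j, a colour class D and a linear-size
   set A in A_0 whose vertices all have D-degree of order np into X and into Z.
   Let w(a, b) count the triangles xyt in X with xy outside D and xa, yb in D.
   As n^2 p^3 -> oo, every linear-size subset of X contains of the order of
   n^3 p^3 triangles (failure probability exp(-omega(n)) beats a union bound over
   the subsets), each of which has an edge outside D; hence w has positive
   relative density on every linear-size K in A.  Now reveal the edges between
   A_0 and Z.  A graph container argument shows that the probability that the
   neighbourhood of a given z contains a subset of size at least c np on which w
   is abnormally small is at most exp(-b np), with b as large as we please; so
   with probability 1 - exp(-b' n^2 p) this fails for only few z, which beats
   the union bound over all colourings of the edges revealed before. *)
Require Import Defs.
From HB Require Import structures.
From mathcomp Require Import all_boot all_order all_algebra.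
From mathcomp Require Import all_classical all_reals all_analysis.
From mathcomp Require Import ring lra zify fintype finset.
Set Implicit Arguments.
Unset Strict Implicit.
Unset Printing Implicit Defensive.
Import Order.TTheory GRing.Theory Num.Theory.
Import numFieldNormedType.Exports.
Local Open Scope ring_scope.
(** * Product measure and resampling *)

Section Expectation.
Variables (R : realType) (n : nat).
Implicit Types (p : R) (G H D : graph n).

Definition Ex p (f : graph n -> R) : R := \sum_(G : graph n) gnp p G * f G.

Lemma gnp_ge0 p G : 0 <= p <= 1 -> 0 <= gnp p G.
Proof.
move=> /andP[p0 p1]; apply: prodr_ge0 => e _.
by case: ifP => _ //; rewrite subr_ge0.
Qed.

Lemma Ex_prod p (u v : edge n -> R) :
  Ex p (fun G => \prod_e (if e \in G then u e else v e)) =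
  \prod_e (p * u e + (1 - p) * v e).
Proof.
rewrite bigA_distr; apply: eq_bigr => G _.
rewrite /gnp -big_split /=; apply: eq_bigr => e _; by case: ifP.
Qed.

Lemma Ex_cst p c : Ex p (fun=> c) = c.
Proof.
rewrite /Ex -mulr_suml; have := Ex_prod p (fun=> 1) (fun=> 1).
rewrite [X in _ = X -> _]big1 => [|e _]; last by ring.
rewrite /Ex => h; rewrite -[RHS]mul1r -h; congr (_ * _).
apply: eq_bigr => G _; rewrite big1 ?mulr1 // => e _; by case: ifP.
Qed.

Lemma eq_Ex p f g : f =1 g -> Ex p f = Ex p g.
Proof. by move=> fg; apply: eq_bigr => G _; rewrite fg. Qed.

Lemma le_Ex p f g : 0 <= p <= 1 -> (forall G, f G <= g G) -> Ex p f <= Ex p g.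
Proof. by move=> p01 fg; apply: ler_sum => G _; rewrite ler_wpM2l ?gnp_ge0. Qed.

Lemma Ex_ge0 p f : 0 <= p <= 1 -> (forall G, 0 <= f G) -> 0 <= Ex p f.
Proof. by move=> p01 f0; rewrite -(Ex_cst p 0) le_Ex. Qed.

Lemma ExD p f g : Ex p (fun G => f G + g G) = Ex p f + Ex p g.
Proof. by rewrite /Ex -big_split; apply: eq_bigr => G _; rewrite mulrDr. Qed.

Lemma ExZ p c f : Ex p (fun G => c * f G) = c * Ex p f.
Proof. by rewrite /Ex mulr_sumr; apply: eq_bigr => G _; rewrite mulrCA. Qed.

Lemma Ex_sum p (I : Type) (r : seq I) (P : pred I) (f : I -> graph n -> R) :
  Ex p (fun G => \sum_(i <- r | P i) f i G) = \sum_(i <- r | P i) Ex p (f i).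
Proof. by rewrite /Ex exchange_big; apply: eq_bigr => G _; rewrite mulr_sumr. Qed.

Lemma markov_Ex p f (t : R) : 0 <= p <= 1 -> (forall G, 0 <= f G) ->
  t * Ex p (fun G => (t <= f G)%R%:R) <= Ex p f.
Proof.
move=> p01 f0; rewrite -ExZ; apply: le_Ex => // G.
by case: (boolP (t <= f G)) => /= h; rewrite ?mulr1 ?mulr0.
Qed.

(* [G] inside [D], resampled as [H] outside [D]: exchanging the two graphs outside
   [D] is an involution that preserves the product measure. *)
Definition mix D G H : graph n := (G :&: D) :|: (H :\: D).

Lemma in_mix D G H e : (e \in mix D G H) = if e \in D then e \in G else e \in H.
Proof. by rewrite !inE; case: (e \in D); rewrite ?andbT ?andbF ?orbF. Qed.

Lemma Ex_mix p D f :
  Ex p f = Ex p (fun G => Ex p (fun H => f (mix D G H))).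
Proof.
transitivity (\sum_(x : graph n * graph n) gnp p x.1 * gnp p x.2 * f x.1).
  rewrite -(pair_big predT predT (fun G H => gnp p G * gnp p H * f G)) /=.
  apply: eq_bigr => G _; rewrite -mulr_suml -mulr_sumr.
  by have := Ex_cst p 1; rewrite /Ex -mulr_suml mulr1 => ->; rewrite mulr1.
pose phi (x : graph n * graph n) := (mix D x.1 x.2, mix D x.2 x.1).
have phiK : involutive phi.
  case=> G H; rewrite /phi /=.
  by congr (_, _); apply/setP => e; rewrite !in_mix; case: (e \in D).
rewrite (reindex_inj (inv_inj phiK)) /Ex.
rewrite -(pair_big predT predT
  (fun G H => gnp p (mix D G H) * gnp p (mix D H G) * f (mix D G H))) /=.
apply: eq_bigr => G _; rewrite mulr_sumr; apply: eq_bigr => H _.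
rewrite mulrA; congr (_ * _); rewrite /gnp -!big_split; apply: eq_bigr => e _.
by rewrite !in_mix; case: (e \in D) => //=; rewrite mulrC.
Qed.

(** The hypotheses say that [f] depends only on the edges in [D] and [g] only on the others. After
    resampling outside [D] the two factors read different graphs, so the double expectation
    splits. *)
Lemma Ex_indep p D f g :
  (forall G, f (G :&: D) = f G) -> (forall G, g (G :\: D) = g G) ->
  Ex p (fun G => f G * g G) = Ex p f * Ex p g.
Proof.
move=> fD gD; rewrite (Ex_mix p D) mulrC -ExZ; apply: eq_Ex => G.
rewrite [RHS]mulrC -ExZ; apply: eq_Ex => H; congr (_ * _).
  rewrite -fD -[RHS]fD; congr f; apply/setP => e.
  by rewrite !inE; case: (e \in D); rewrite ?andbF ?orbF ?andbT.
rewrite -gD -[RHS]gD; congr g; apply/setP => e.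
by rewrite !inE; case: (e \in D) => //=; rewrite ?andbF ?orbF.
Qed.

Lemma Ex_prod_indep p (I : eqType) (s : seq I) (D : I -> graph n)
    (f : I -> graph n -> R) : uniq s ->
  (forall i, i \in s -> forall G, f i (G :&: D i) = f i G) ->
  {in s &, forall i j, i != j -> forall G, f j (G :\: D i) = f j G} ->
  Ex p (fun G => \prod_(i <- s) f i G) = \prod_(i <- s) Ex p (f i).
Proof.
elim: s => [|i s IHs] /=.
  by move=> _ _ _; rewrite big_nil -[RHS](Ex_cst p); apply: eq_Ex => G; rewrite big_nil.
move=> /andP[inots us] fD fN; rewrite big_cons -IHs //; first last.
- by move=> j k js ks; apply: fN; rewrite inE ?js ?ks orbT.
- by move=> j js; apply: fD; rewrite inE js orbT.
rewrite -(@Ex_indep p (D i)); first by apply: eq_Ex => G; rewrite big_cons.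
  by move=> G; apply: fD; rewrite mem_head.
move=> G; rewrite !big_seq; apply: eq_bigr => j js; apply: fN => //.
- exact: mem_head.
- by rewrite inE js orbT.
- by apply: contraNneq inots => ->.
Qed.

Lemma sub_prod (S : {set edge n}) G :
  ((S \subset G)%:R : R) = \prod_e (if e \in G then 1 else (e \notin S)%:R).
Proof.
case: (boolP (S \subset G)) => [/subsetP SG | /subsetPn[e eS eG]].
  rewrite big1 // => e _; case: ifP => // /negbT h.
  by rewrite (contra (SG e) h).
by rewrite (bigD1 e) //= (negbTE eG) eS mul0r.
Qed.

Lemma Ex_sub p (S : {set edge n}) : Ex p (fun G => (S \subset G)%:R) = p ^+ #|S|.
Proof.
under eq_Ex do rewrite sub_prod.
rewrite (Ex_prod p (fun=> 1)) -prodr_const [RHS]big_mkcond /=; apply: eq_bigr => e _.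
by case: (e \in S) => /=; ring.
Qed.

Lemma Ex_sub2 p (S T : {set edge n}) :
  Ex p (fun G => (S \subset G)%:R * (T \subset G)%:R) = p ^+ #|S :|: T|.
Proof. by rewrite -Ex_sub; apply: eq_Ex => G; rewrite subUset -natrM mulnb. Qed.

(** Chebyshev's inequality for the number of sets [S i] contained in the random graph: pairs with
    disjoint sets contribute at most [mu ^+ 2] to the second moment, so intersecting pairs bound the
    variance. The product form on the left covers [mu = 0] as well. *)
Lemma chebyshev_sub p (I : finType) (Q : pred I) (S : I -> {set edge n}) :
  let mu := \sum_(i | Q i) p ^+ #|S i| in
  0 <= p <= 1 ->
  Ex p (fun G => (\sum_(i | Q i) (S i \subset G)%:R < mu / 2)%R%:R) * mu ^+ 2 <=
  4 * \sum_(i | Q i) \sum_(j | Q j && ~~ [disjoint S i & S j]) p ^+ #|S i :|: S j|.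
Proof.
move=> mu p01; set Delta := \sum_(i | Q i) _.
have p0 : 0 <= p by case/andP: p01.
have mu0 : 0 <= mu by apply: sumr_ge0 => i _; rewrite exprn_ge0.
pose Z G : R := \sum_(i | Q i) (S i \subset G)%:R.
have EZ : Ex p Z = mu by rewrite Ex_sum; apply: eq_bigr => i _; rewrite Ex_sub.
have EZ2 : Ex p (fun G => Z G ^+ 2) <= mu ^+ 2 + Delta.
  have -> : Ex p (fun G => Z G ^+ 2) =
      \sum_(i | Q i) \sum_(j | Q j) p ^+ #|S i :|: S j|.
    under eq_Ex do rewrite expr2 big_distrlr /=.
    rewrite Ex_sum; apply: eq_bigr => i _; rewrite Ex_sum; apply: eq_bigr => j _.
    exact: Ex_sub2.
  rewrite expr2 big_distrlr -big_split /=; apply: ler_sum => i _.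
  rewrite (bigID (fun j => [disjoint S i & S j])) /= lerD2r.
  rewrite [X in _ <= X](bigID (fun j => [disjoint S i & S j])) /=.
  rewrite ler_wpDr //; first by apply: sumr_ge0 => j _; rewrite mulr_ge0 ?exprn_ge0.
  apply: ler_sum => j /andP[_ dij].
  by rewrite cardsU (disjoint_setI0 dij) cards0 subn0 exprD.
have Evar : Ex p (fun G => (Z G - mu) ^+ 2) <= Delta.
  have -> : Ex p (fun G => (Z G - mu) ^+ 2) =
      Ex p (fun G => Z G ^+ 2) + ((- 2 * mu) * Ex p Z + Ex p (fun=> mu ^+ 2)).
    rewrite -ExZ -!ExD; apply: eq_Ex => G; ring.
  rewrite EZ Ex_cst; nra.
apply: le_trans (ler_wpM2l _ Evar) => //.
rewrite -ExZ mulrC -ExZ; apply: le_Ex => // G.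
rewrite -/(Z G); case: ltP => /= h; last by rewrite mulr0 mulr_ge0 ?sqr_ge0.
rewrite mulr1; nra.
Qed.

End Expectation.

(** * Neighbourhoods as independent rows *)

Section Adjacency.
Variable (n : nat).
Implicit Types (G H D : graph n) (x y v w : 'I_n).

Definition adj G x y : bool := [exists e in G, val e == [set x; y]].

Definition nbr G v : {set 'I_n} := [set w | adj G v w].

Definition pairs_edges (F : {set {set 'I_n}}) : {set edge n} := [set e | val e \in F].

Lemma adjC G x y : adj G x y = adj G y x.
Proof. by rewrite /adj setUC. Qed.

Lemma adjS G H x y : G \subset H -> adj G x y -> adj H x y.
Proof.
move=> /subsetP GH /exists_inP[e eG exy].
by apply/exists_inP; exists e; rewrite ?GH.
Qed.

Lemma adj_neq G x y : adj G x y -> x != y.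
Proof.
move=> /exists_inP[e _ /eqP exy]; have /eqP := valP e.
by rewrite /= exy cards2; case: eqP.
Qed.

Lemma eq_adj G H x y : {in [pred e | val e == [set x; y]], G =i H} ->
  adj G x y = adj H x y.
Proof.
move=> GH; apply: eq_existsb => e; rewrite andbC [RHS]andbC.
by case: (boolP (val e == _)) => //= exy; rewrite GH.
Qed.

Lemma card_pairs_edges (F : {set {set 'I_n}}) :
  (forall A, A \in F -> #|A| = 2%N) -> #|pairs_edges F| = #|F|.
Proof.
move=> F2; rewrite -(card_imset _ val_inj); congr #|pred_of_set _|.
apply/setP => A; apply/imsetP/idP => [[e]|AF]; first by rewrite inE => ? ->.
have A2 : #|A| == 2%N by rewrite F2.
by exists (exist (fun A : {set 'I_n} => #|A| == 2%N) A A2); rewrite ?inE.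
Qed.

Lemma pairs_edges_sub G (F : {set {set 'I_n}}) x y :
  x != y -> [set x; y] \in F -> pairs_edges F \subset G -> adj G x y.
Proof.
move=> xy xyF /subsetP FG; have xy2 : #|[set x; y]| == 2%N by rewrite cards2 xy.
by apply/exists_inP; exists (exist (fun A : {set 'I_n} => #|A| == 2%N) _ xy2) => //; apply: FG; rewrite inE.
Qed.

Lemma sub_pairs_edges G (F : {set {set 'I_n}}) :
  (forall A, A \in F -> exists x y, A = [set x; y] /\ adj G x y) ->
  pairs_edges F \subset G.
Proof.
move=> h; apply/subsetP => e; rewrite inE => /h[x [y [exy /exists_inP[e' e'G]]]].
by rewrite -exy => /eqP /val_inj <-.
Qed.

Definition cross (M W : {set 'I_n}) : {set edge n} :=
  [set e : edge n | ~~ [disjoint val e & M] && ~~ [disjoint val e & W]].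

Lemma in_cross M W e v w : val e = [set v; w] ->
  (e \in cross M W) = ((v \in M) || (w \in M)) && ((v \in W) || (w \in W)).
Proof.
by move=> ee; rewrite inE ee !disjoints_subset !subUset !sub1set !inE !negb_and !negbK.
Qed.

End Adjacency.

Section Rows.
Variables (R : realType) (n : nat).
Implicit Types (p : R) (G : graph n) (v : 'I_n).

(** Union bound over the possible sets of bad vertices. The event at a vertex [v] of [M] depends
    only on the pairs from [v] to [W]; these sets of pairs are disjoint for different [v] because
    [M] and [W] are disjoint, so the probabilities multiply. *)
Lemma rows_tail p (M W : {set 'I_n}) (B : 'I_n -> {set 'I_n} -> bool) (b g : R) :
  0 <= p <= 1 -> [disjoint M & W] -> 0 <= b ->
  (forall v, v \in M -> Ex p (fun G => (B v (nbr G v :&: W))%:R) <= expR (- b)) ->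
  Ex p (fun G => (g <= #|[set v in M | B v (nbr G v :&: W)]|%:R)%R%:R) <=
  2 ^+ n * expR (- (b * g)).
Proof.
move=> p01 dMW b0 hB.
pose f v G : R := (B v (nbr G v :&: W))%:R.
have EM (A : {set 'I_n}) : A \subset M ->
    Ex p (fun G => \prod_(v in A) f v G) = \prod_(v in A) Ex p (f v).
  move=> /subsetP AM.
  rewrite -big_enum -(@Ex_prod_indep R n p _ (enum A) (fun v => cross [set v] W)).
  - by apply: eq_Ex => G; rewrite big_enum.
  - exact: enum_uniq.
  - move=> v; rewrite mem_enum => /AM vM G; rewrite /f.
    do 2 congr (_ _); congr (B v _); apply/setP => w; rewrite !inE.
    case: (boolP (w \in W)) => wW; rewrite ?andbF ?andbT //.
    apply: eq_adj => e /eqP ee; rewrite inE (in_cross _ _ ee) !inE eqxx wW.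
    by rewrite orbT !andbT.
  - move=> v u; rewrite !mem_enum => /AM vM /AM uM vu G; rewrite /f.
    do 2 congr (_ _); congr (B u _); apply/setP => w; rewrite !inE.
    case: (boolP (w \in W)) => wW; rewrite ?andbF ?andbT //.
    apply: eq_adj => e /eqP ee; rewrite inE (in_cross _ _ ee) !inE wW.
    rewrite eq_sym (negbTE vu) /=; case: eqP => [wv|] //=.
    by have := disjointFr dMW vM; rewrite -wv wW.
apply: (@le_trans _ _ (\sum_(A : {set 'I_n} | (A \subset M) && (g <= #|A|%:R)%R)
    Ex p (fun G => \prod_(v in A) f v G))).
  rewrite -Ex_sum; apply: le_Ex => // G.
  set A := [set v in M | _]; case: (boolP (g <= _)) => /= gA; last first.
    by apply: sumr_ge0 => ? _; apply: prodr_ge0.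
  rewrite (bigD1 A) /=; last by rewrite gA andbT; apply/subsetP => v; rewrite inE => /andP[].
  rewrite [X in X + _]big1 ?ler_wpDr //; last first.
    by move=> v; rewrite inE /f => /andP[_ ->].
  by apply: sumr_ge0 => ? _; apply: prodr_ge0.
apply: (@le_trans _ _ (\sum_(A : {set 'I_n}) expR (- (b * g)))); last first.
  rewrite sumr_const (_ : #|_| = (2 ^ n)%N); first by rewrite -[X in X <= _]mulr_natl natrX.
  by rewrite -cardsT -powersetT card_powerset cardsT card_ord.
rewrite big_mkcond; apply: ler_sum => A _; case: ifP => [/andP[AM gA]|_]; last exact: expR_ge0.
rewrite EM //; apply: (@le_trans _ _ (\prod_(v in A) expR (- b))).
  apply: ler_prod => v vA; rewrite Ex_ge0 //= hB //; exact: (subsetP AM).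
by rewrite prodr_const -expRM_natl ler_expR mulrN lerN2 mulrC ler_wpM2r.
Qed.

(* Given the edges outside [cross M W], the neighbourhoods in [W] of the vertices of
   [M] are independent; [i] ranges over data (such as colourings) that may depend on
   the edges outside [cross M W]. *)
Lemma cond_rows_tail p (M W : {set 'I_n}) (I : finType) (J : graph n -> pred I)
    (B : graph n -> I -> 'I_n -> {set 'I_n} -> bool) (b g K : R) :
  0 <= p <= 1 -> [disjoint M & W] -> 0 <= b ->
  (forall G, #|J G|%:R <= K) ->
  (forall G i v, J G i -> v \in M ->
     Ex p (fun H => (B G i v (nbr H v :&: W))%:R) <= expR (- b)) ->
  Ex p (fun G => [exists i, J (G :\: cross M W) i &&
      (g <= #|[set v in M | B (G :\: cross M W) i v (nbr G v :&: W)]|%:R)]%:R) <=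
  K * (2 ^+ n * expR (- (b * g))).
Proof.
move=> p01 dMW b0 JK hB.
set D := cross M W.
(* Keep [G] outside [D] and redraw [D] as [H]: by [mixD] the data see only [G], by [mixN] the rows
   see only [H]. *)
rewrite (Ex_mix p (~: D)) -[X in _ <= X](Ex_cst n p); apply: le_Ex => // G.
have mixD H : mix (~: D) G H :\: D = G :\: D.
  by apply/setP => e; rewrite in_setD in_mix !in_setD in_setC; case: (e \in D).
have mixN H v : v \in M -> nbr (mix (~: D) G H) v :&: W = nbr H v :&: W.
  move=> vM; apply/setP => w; rewrite !inE.
  case: (boolP (w \in W)) => wW; rewrite ?andbF ?andbT //.
  apply: eq_adj => e /eqP ee; rewrite in_mix in_setC (in_cross _ _ ee) vM wW.
  by rewrite orbT.
apply: (@le_trans _ _ (\sum_(i | J (G :\: D) i) 2 ^+ n * expR (- (b * g)))); last first.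
  rewrite sumr_const -[X in X <= _]mulr_natl; apply: ler_wpM2r; last exact: JK.
  by rewrite mulr_ge0 ?exprn_ge0 ?expR_ge0.
apply: (@le_trans _ _ (\sum_(i | J (G :\: D) i)
   Ex p (fun H => (g <= #|[set v in M | B (G :\: D) i v (nbr H v :&: W)]|%:R)%R%:R))).
  rewrite -Ex_sum; apply: le_Ex => // H; rewrite mixD.
  case: existsP => [[i /andP[Ji gi]]|_] /=; last exact: sumr_ge0.
  rewrite (bigD1 i) //= -[X in X <= _]addr0 lerD ?sumr_ge0 //.
  rewrite (_ : [set v in M | B (G :\: D) i v (nbr H v :&: W)] =
    [set v in M | B (G :\: D) i v (nbr (mix (~: D) G H) v :&: W)]) ?gi //.
  by apply/setP => v; rewrite !inE; case: (boolP (v \in M)) => //= vM; rewrite mixN.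
by apply: ler_sum => i Ji; apply: rows_tail => // v vM; apply: hB.
Qed.

End Rows.

(** * A weighted graph container *)

Section Container.
Variables (R : realType) (T : finType) (w : T -> T -> R) (A : {set T}) (theta g : R).
Hypothesis w_ge0 : forall v a, 0 <= w v a.
Hypothesis theta_ge0 : 0 <= theta.
Implicit Types (F S K N : {set T}).

Definition hit F a : R := \sum_(v in F) w v a.

(** The lightly hit vertices that may belong to [S] without belonging to its fingerprint [F]: adding
    one of them to [F] need not gain its price [g]. The set is determined by [F] alone. *)
Definition container F : {set T} :=
  [set v in A :\: F | (hit F v <= theta / 2) &&
     (\sum_(a in A | hit F a <= theta / 2) Num.min (w v a) (theta / 2) <= g)].

Lemma hit_ge0 F a : 0 <= hit F a.
Proof. exact: sumr_ge0. Qed.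

(* The fingerprint of [S] is a subset [F] maximising
   [\sum_(a in A) min (hit F a) theta - g * #|F|]. *)
Lemma fingerprint S : S \subset A ->
  exists F, [/\ F \subset S, #|F|%:R * g <= theta * #|A|%:R &
    forall v, v \in S -> v \notin F -> hit F v <= theta / 2 -> v \in container F].
Proof.
move=> SA; pose Phi F := \sum_(a in A) Num.min (hit F a) theta.
pose gain F := Phi F - g * #|F|%:R.
pose F := [arg max_(F > set0 | F \subset S) gain F]%O.
have [FS Fmax] : F \subset S /\ forall F', F' \subset S -> gain F' <= gain F.
  by rewrite /F; case: arg_maxP => [|F' F'S h]; rewrite ?sub0set.
exists F; split => //.
  have := Fmax set0 (sub0set _); rewrite /gain cards0 mulr0 subr0.
  have Phi0 : 0 <= Phi set0.
    by apply: sumr_ge0 => a _; rewrite le_min hit_ge0.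
  have PhiF : Phi F <= theta * #|A|%:R.
    rewrite mulr_natr -sumr_const; apply: ler_sum => a _.
    by rewrite ge_min lexx orbT.
  by move: (#|F|%:R) => x; lra.
move=> v vS vF hv; rewrite inE in_setD vF (subsetP SA) //= hv /=.
have hitU a : hit (v |: F) a = w v a + hit F a by rewrite /hit big_setU1.
pose gw a := if hit F a <= theta / 2 then Num.min (w v a) (theta / 2) else 0.
(* Where [hit F a] is at most [theta / 2] there is room [theta / 2] below the cap, so adding [v]
   gains at least the minimum of [w v a] and [theta / 2]. *)
have : Phi F + \sum_(a in A) gw a <= Phi (v |: F).
  rewrite /Phi -big_split /=; apply: ler_sum => a _; rewrite hitU /gw.
  have := w_ge0 v a; have := hit_ge0 F a; move: (hit F a) (w v a) => h u h0 u0.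
  have t0 := theta_ge0; rewrite !minEle.
  by do ! case: ifP => [?|/negbT]; rewrite -?ltNge => *; lra.
rewrite -big_mkcondr /= => PhiU.
have : gain (v |: F) <= gain F by apply: Fmax; rewrite subUset sub1set vS.
rewrite /gain cardsU1 vF natrD mulrDr mulr1; move: PhiU; move: (#|F|%:R) => x; lra.
Qed.

(** All vertices of the container are lightly hit, so each has capped weight at most [g] into the
    container. The total is at most [g * #|A|], which the density hypothesis excludes for a set of
    size [eta] or more. *)
Lemma container_small F (eta : R) : 0 < eta ->
  (forall K, K \subset A -> eta <= #|K|%:R ->
     g * #|A|%:R < \sum_(v in K) \sum_(a in K) Num.min (w v a) (theta / 2)) ->
  0 <= g -> #|container F|%:R < eta.
Proof.
move=> eta0 LD g0; have KA : container F \subset A.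
  by apply/subsetP => v; rewrite !inE => /andP[/andP[_ ->]].
rewrite ltNge; apply/negP => /(LD _ KA); apply/negP; rewrite -leNgt.
apply: (@le_trans _ _ (\sum_(v in container F) g)); last first.
  by rewrite sumr_const -[X in X <= _]mulr_natr ler_wpM2l // ler_nat subset_leq_card.
apply: ler_sum => v; rewrite inE => /andP[_ /andP[_]]; apply: le_trans.
rewrite [X in X <= _]big_mkcond [X in _ <= X]big_mkcond; apply: ler_sum => a _.
case: ifP => [|_].
  by rewrite 2!inE => /andP[/andP[_ ->] /andP[-> _]].
by case: ifP => // _; rewrite le_min w_ge0 divr_ge0.
Qed.

(** A vertex of [S] hit by more than [theta / 2] receives this weight from inside [S], as the
    fingerprint is a subset of [S]; since [S] is light, at most [s / 2] vertices are of this kind.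
    The others are in [F] or in the container. *)
Lemma light_set_fingerprint S N (s : R) : S \subset A -> S \subset N -> 0 < theta ->
  s <= #|S|%:R -> \sum_(v in S) \sum_(a in S) w v a <= theta * s / 4 ->
  exists F, [/\ F \subset A, F \subset N, #|F|%:R * g <= theta * #|A|%:R &
    s / 2 - #|F|%:R <= #|N :&: container F|%:R].
Proof.
move=> SA SN t0 sS wS; have [F [FS Fg SF]] := fingerprint SA.
exists F; split=> //; try exact: (subset_trans FS).
pose C := [set a in S | theta / 2 < hit F a].
have CS : #|C|%:R <= s / 2.
  have : #|C|%:R * (theta / 2) <= theta * s / 4.
    apply: le_trans wS; rewrite exchange_big /= mulr_natl -sumr_const.
    rewrite [X in _ <= X](bigID (mem C)) /= ler_wpDr //.
      by apply: sumr_ge0 => a _; apply: sumr_ge0.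
    rewrite [X in _ <= X](eq_bigl (mem C)); last first.
      by move=> a; rewrite !inE andbA andbb.
    apply: ler_sum => a; rewrite inE => /andP[_ /ltW h]; apply: (le_trans h).
    rewrite /hit [X in _ <= X](bigID (mem F)) /= ler_wpDr ?sumr_ge0 //.
    by rewrite [X in _ <= X](eq_bigl (mem F)) // => v; rewrite andbC; apply/andb_idr/subsetP.
  by nra.
have : (#|S| <= #|C| + (#|F| + #|N :&: container F|))%N.
  apply: leq_trans (_ : #|C :|: (F :|: (N :&: container F))| <= _)%N; last first.
    rewrite (leq_trans (leq_card_setU _ _)) // leq_add2l.
    exact: leq_card_setU.
  apply/subset_leq_card/subsetP => v vS; rewrite !in_setU.
  case: (boolP (v \in C)) => //= vC; case: (boolP (v \in F)) => //= vF.
  rewrite in_setI (subsetP SN) //=; apply: SF => //.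
  by move: vC; rewrite inE vS /= -leNgt.
rewrite -(ler_nat R) !natrD; lra.
Qed.

End Container.

(** * Light sets in a random neighbourhood *)

Section RandomNeighbourhood.
Variables (R : realType) (n : nat).
Implicit Types (p : R) (G : graph n) (z : 'I_n) (F K W : {set 'I_n}).

Definition star z W : {set edge n} := pairs_edges [set [set z; a] | a in W].

Lemma card_star_image z W : z \notin W -> #|star z W| = #|W|.
Proof.
move=> zW; rewrite card_pairs_edges.
  apply: card_in_imset => a b aW bW /setP /(_ a).
  rewrite !inE eqxx orbT; case: (eqVneq a b) => //= _.
  by rewrite orbF => /esym /eqP az; rewrite -az aW in zW.
by move=> _ /imsetP[a aW ->]; rewrite cards2; case: eqP => // za; rewrite za aW in zW.
Qed.

Lemma card_nbr G z W : z \notin W -> #|nbr G z :&: W| = #|star z W :&: G|.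
Proof.
move=> zW; rewrite -(@card_star_image z (nbr G z :&: W)); last first.
  by rewrite inE (negbTE zW) andbF.
congr #|pred_of_set _|; apply/setP => e; rewrite !inE.
apply/imsetP/andP => [[a /setIP[]]|[/imsetP[a aW ea] eG]].
  rewrite inE => /exists_inP[e' e'G /eqP e'a] aW ea; split; first by apply/imsetP; exists a.
  by rewrite (_ : e = e') //; apply: val_inj; rewrite ea.
by exists a; rewrite // !inE aW andbT; apply/exists_inP; exists e; rewrite ?ea.
Qed.

(** The pairs from [z] to [F] and to [K] are distinct, so the event on [F] is independent of the
    degree into [K], which is binomial. *)
Lemma Ex_fingerprint p z F K (x : R) : z \notin F -> z \notin K -> [disjoint F & K] ->
  Ex p (fun G => (F \subset nbr G z)%:R * x ^+ #|nbr G z :&: K|) =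
  p ^+ #|F| * (p * x + (1 - p)) ^+ #|K|.
Proof.
move=> zF zK dFK.
have dFK' e : e \in star z F -> e \in star z K -> false.
  rewrite !inE => /imsetP[a aF ->] /imsetP[b bK] /setP /(_ a).
  rewrite !inE eqxx orbT => /esym/orP[] /eqP h; first by rewrite h (negbTE zF) in aF.
  by have := disjointFr dFK aF; rewrite h bK.
pose u e : R := if e \in star z K then x else 1.
pose v e : R := (e \notin star z F)%:R.
have -> : Ex p (fun G => (F \subset nbr G z)%:R * x ^+ #|nbr G z :&: K|) =
    Ex p (fun G => \prod_e (if e \in G then u e else v e)).
  apply: eq_Ex => G; rewrite (_ : (F \subset nbr G z) = (star z F \subset G)); last first.
    apply/subsetP/idP => [h|h a aF].
      apply: sub_pairs_edges => _ /imsetP[a aF ->]; exists z, a; split=> //.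
      by have := h _ aF; rewrite inE.
    rewrite inE; apply: pairs_edges_sub h; last exact: imset_f.
    by apply: contraNneq zF => ->.
  rewrite card_nbr // sub_prod -prodr_const [X in _ * X]big_mkcond -big_split /=.
  apply: eq_bigr => e _; rewrite /u /v in_setI.
  by case: (e \in G); case: (e \in star z K); rewrite ?mulr1 ?mul1r.
rewrite Ex_prod -(card_star_image zF) -(card_star_image zK) -!prodr_const.
rewrite [X in X * _]big_mkcond [X in _ * X]big_mkcond -big_split /=.
apply: eq_bigr => e _; rewrite /u /v; have := @dFK' e.
case: (e \in star z F); case: (e \in star z K) => //= h; try ring.
by case: (h isT isT).
Qed.

Lemma sum_subsets (x : R) : \sum_(F : {set 'I_n}) x ^+ #|F| = (1 + x) ^+ n.
Proof.
rewrite -[n in RHS](card_ord n) -prodr_const addrC bigA_distr.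
by apply: eq_bigr => F _; rewrite -prodr_const big_mkcond.
Qed.

(** Sum over the fingerprints [F] of light sets, with an exponential Markov bound for the many
    neighbours in the container of [F]. The weight [expR (- l) ^+ #|F|] tames the number of
    fingerprints and leads to the term [n%:R * p * expR (- l)]; the exponential moment on a
    container smaller than [eta] leads to [expR l * p * eta]. *)
Lemma light_neighbourhood p z (w : 'I_n -> 'I_n -> R) (A : {set 'I_n})
    (theta g eta s k l : R) :
  0 <= p <= 1 -> (forall v a, 0 <= w v a) -> 0 < theta -> 0 < g -> 0 < eta -> 0 <= l ->
  z \notin A ->
  (forall K, K \subset A -> eta <= #|K|%:R ->
     g * #|A|%:R < \sum_(v in K) \sum_(a in K) Num.min (w v a) (theta / 2)) ->
  theta * #|A|%:R <= k * g ->
  Ex p (fun G => [exists S : {set 'I_n}, [&& S \subset nbr G z :&: A, s <= #|S|%:R &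
     \sum_(v in S) \sum_(a in S) w v a <= theta * s / 4]]%:R) <=
  expR (l * (2 * k - s / 2) + n%:R * p * expR (- l) + expR l * p * eta).
Proof.
move=> p01 w0 t0 g0 eta0 l0 zA LD tk; have /andP[p0 p1] := p01.
pose cont := container w A theta g.
have contA F : cont F \subset A.
  by apply/subsetP => v; rewrite !inE => /andP[/andP[_ ->]].
have contD F : [disjoint F & cont F].
  rewrite disjoint_sym disjoints_subset; apply/subsetP => v; rewrite !inE.
  by case: (v \in F).
pose L := expR (l * (2 * k - s / 2)).
pose f F G := (F \subset nbr G z)%:R * expR l ^+ #|nbr G z :&: cont F|.
apply: (@le_trans _ _ (\sum_(F : {set 'I_n} | F \subset A)
   L * (expR (- l) ^+ #|F| * Ex p (f F)))).
  under eq_bigr do rewrite -ExZ -ExZ.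
  rewrite -Ex_sum; apply: le_Ex => // G.
  have tm F : 0 <= L * (expR (- l) ^+ #|F| * f F G).
    by rewrite !mulr_ge0 ?exprn_ge0 ?expR_ge0.
  case: existsP => [[S /and3P[]]|_]; last exact: sumr_ge0.
  rewrite subsetI => /andP[SN SA] sS wS.
  have [F [FA FN Fg Fs]] := light_set_fingerprint g w0 (ltW t0) SA SN t0 sS wS.
  rewrite (bigD1 F) //= -[X in X <= _]addr0 lerD ?sumr_ge0 //.
  rewrite /f FN mul1r /L -!expRM_natl -!expRD -[X in X <= _]expR0 ler_expR.
  (* With [a] the size of [F] and [b] the number of neighbours in its container,
     [2 * k - s / 2 - a + b] is at least [2 * (k - a)]: one [k] pays for the loss in the container
     bound, the other for the weight of [F]. *)
  have : #|F|%:R <= k by rewrite -(ler_pM2r g0); exact: le_trans Fg tk.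
  move: Fs; rewrite -/(cont F); move: (#|F|%:R) (#|nbr G z :&: cont F|%:R) => a b h1 h2.
  have : 0 <= l * (2 * k - s / 2 - a + b) by rewrite mulr_ge0 //; lra.
  lra.
rewrite -mulr_sumr !expRD -/L -!mulrA ler_wpM2l ?expR_ge0 //.
apply: (@le_trans _ _ (\sum_(F : {set 'I_n})
   (expR (- l) * p) ^+ #|F| * expR (expR l * (p * eta)))).
  rewrite big_mkcond /=; apply: ler_sum => F _; case: ifP => FA; last first.
    by rewrite mulr_ge0 ?exprn_ge0 ?mulr_ge0 ?expR_ge0.
  have zF : z \notin F by apply: contra zA => /(subsetP FA).
  have zC : z \notin cont F by apply: contra zA => /(subsetP (contA F)).
  rewrite Ex_fingerprint // mulrA -exprMn; apply: ler_wpM2l.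
    by rewrite exprn_ge0 // mulr_ge0 ?expR_ge0.
  apply: (@le_trans _ _ (expR (p * expR l) ^+ #|cont F|)).
    apply: lerXn2r; rewrite ?nnegrE ?expR_ge0 //.
      have := expR_ge0 l; nra.
    by apply: le_trans (expR_ge1Dx _); lra.
  rewrite -expRM_natl ler_expR.
  have : #|cont F|%:R < eta by apply: container_small => //; exact: ltW.
  move: #|_|%:R => c; have := expR_ge0 l; move: (expR l) => y y0 /ltW ce.
  have py : 0 <= p * y by rewrite mulr_ge0.
  nra.
rewrite -mulr_suml sum_subsets ler_wpM2r ?expR_ge0 //.
rewrite [X in _ <= X]expRM_natl; apply: lerXn2r; rewrite ?nnegrE ?expR_ge0 //.
  by rewrite addr_ge0 // mulr_ge0 ?expR_ge0.
by rewrite mulrC; exact: expR_ge1Dx.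
Qed.

End RandomNeighbourhood.

(** * Pairs of copies of a pattern *)

Section Copies.
Variables (R : realType) (n k : nat).
Implicit Types (p q : R) (G : graph n) (s : {ffun 'I_k -> 'I_n}) (L : seq ('I_k * 'I_k)).
Implicit Types (O : {set 'I_k}).

Definition copy L s : {set edge n} :=
  pairs_edges [set [set s l.1; s l.2] | l in L].

(** Listing each pair in increasing order excludes loops and the same edge in both directions. *)
Definition simple L : bool := uniq L && all (fun l : 'I_k * 'I_k => l.1 < l.2)%N L.

Definition overlap s s' : {set 'I_k} := [set i | s i \in codom s'].

(* The edges of the pattern with both ends in [O] contribute [1] instead of [p]. *)
Definition outer_weight p L O : R :=
  \prod_(l <- L) (if (l.1 \in O) && (l.2 \in O) then 1 else p).

Lemma card_copy L s : injective s -> simple L -> #|copy L s| = size L.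
Proof.
move=> si /andP[uL /allP ltL]; rewrite card_pairs_edges => [|_ /imsetP[l /ltL ltl ->]].
  rewrite -(card_uniqP uL); apply: card_in_imset => -[a b] [c d] /ltL /= ab /ltL /= cd.
  move=> /setP E; have := E (s a); have := E (s b).
  rewrite !inE !eqxx orbT !(inj_eq si) /=.
  case: (eqVneq b d) => [ebd|_]; case: (eqVneq a c) => [eac|_] //=; rewrite ?orbF ?orbT.
  - by rewrite ebd eac.
  - by move=> _ /esym/eqP e; rewrite e -ebd ltnn in ab.
  - by move=> /esym/eqP e; rewrite e eac ltnn in ab.
  - by move=> /esym/eqP e1 /esym/eqP e2; rewrite e1 e2 in ab; have := ltn_trans ab cd; rewrite ltnn.
by rewrite cards2 (inj_eq si); case: eqP => // e; rewrite e ltnn in ltl.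
Qed.

(** An edge of the first copy with an end outside the overlap is not an edge of the second. The
    union therefore has at least [size L] edges plus the number of such edges, and [p <= 1]. *)
Lemma copyU_weight p L s s' : 0 <= p <= 1 -> injective s -> injective s' -> simple L ->
  p ^+ #|copy L s :|: copy L s'| <= p ^+ size L * outer_weight p L (overlap s s').
Proof.
move=> /andP[p0 p1] si si' sL; set O := overlap s s'.
pose L' := [seq l <- L | ~~ ((l.1 \in O) && (l.2 \in O))].
have -> : outer_weight p L O = p ^+ size L'.
  rewrite size_filter /outer_weight /=; elim: (L) => [|l r IHr]; first by rewrite big_nil.
  rewrite big_cons {}IHr /=; case: ifP => _ /=; first by rewrite mul1r.
  by rewrite add1n exprS.
have sL' : simple L'.
  case/andP: sL => uL aL; rewrite /simple filter_uniq //=.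
  by rewrite all_filter; apply: sub_all aL => l /= ltl; rewrite ltl implybT.
rewrite -exprD; apply: ler_wiXn2l => //.
rewrite -(card_copy si' sL) -(card_copy si sL').
rewrite (leq_trans _ (subset_leq_card (_ : copy L s' :|: copy L' s \subset _))) //.
  have [_ cardE] := leq_card_setU (copy L s') (copy L' s).
  apply/eq_leq/esym/eqP; rewrite cardE disjoint_sym disjoints_subset; apply/subsetP => e; rewrite !inE.
  move=> /imsetP[l]; rewrite mem_filter => /andP[lO _] ->.
  apply: contra lO => /imsetP[l' _ /setP E]; rewrite !inE.
  have := E (s l.1); have := E (s l.2); rewrite !inE !eqxx orbT /=.
  by move=> /esym/orP[]/eqP-> /esym/orP[]/eqP->; rewrite !codom_f.
rewrite setUC; apply: setSU; apply/subsetP => e; rewrite !inE => /imsetP[l].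
by rewrite mem_filter => /andP[_ lL] ->; apply: imset_f.
Qed.

(** Pairs are grouped by their overlap [O]. Given [s'], each position in [O] has at most [k] values
    and each other position at most [n]. The edges of [Lp] must appear in the random graph, those of
    [Lq] only carry a weight [q] each. *)
Lemma Ex_copy_pairs p q (Lp Lq : seq ('I_k * 'I_k)) (P : pred {set 'I_k}) :
  0 <= p <= 1 -> 0 <= q <= 1 -> simple Lp -> simple Lq ->
  Ex p (fun G => \sum_(s' : {ffun 'I_k -> 'I_n} | injectiveb s')
     \sum_(s : {ffun 'I_k -> 'I_n} | injectiveb s && P (overlap s s'))
     (copy Lp s \subset G)%:R * (copy Lp s' \subset G)%:R *
     q ^+ #|copy Lq s :|: copy Lq s'|) <=
  n%:R ^+ k * p ^+ size Lp * q ^+ size Lq *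
  \sum_(O | P O) (\prod_i (if i \in O then k%:R else n%:R)) *
    outer_weight p Lp O * outer_weight q Lq O.
Proof.
move=> p01 q01 sLp sLq; have /andP[p0 p1] := p01; have /andP[q0 q1] := q01.
have ow0 r L O : 0 <= r -> 0 <= outer_weight r L O.
  by move=> r0; apply: prodr_ge0 => l _; case: ifP.
pose t O := p ^+ size Lp * outer_weight p Lp O * (q ^+ size Lq * outer_weight q Lq O).
have t0 O : 0 <= t O by rewrite !mulr_ge0 ?exprn_ge0 ?ow0.
rewrite Ex_sum; apply: (@le_trans _ _ (\sum_(s' : {ffun 'I_k -> 'I_n})
  \sum_(O | P O) t O * \prod_i (if i \in O then k%:R else n%:R))); last first.
  rewrite sumr_const card_ffun !card_ord -[X in X <= _]mulr_natl natrX -!mulrA.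
  rewrite ler_wpM2l ?exprn_ge0 // !mulr_sumr; apply: ler_sum => O _.
  by rewrite /t; lra.
rewrite big_mkcond; apply: ler_sum => s' _; case: ifP => [/injectiveP si'|_]; last first.
  by apply: sumr_ge0 => O _; rewrite mulr_ge0 ?prodr_ge0 // => i _; case: ifP.
rewrite Ex_sum; apply: (@le_trans _ _ (\sum_(s : {ffun 'I_k -> 'I_n}) \sum_(O | P O)
   t O * \prod_i (if (i \in O) ==> (s i \in codom s') then 1 else 0 : R))).
  rewrite big_mkcond; apply: ler_sum => s _; case: ifP => [/andP[/injectiveP si PO]|_].
    rewrite (bigD1 (overlap s s')) //= -[X in X <= _]addr0 lerD //.
      rewrite [X in _ * X]big1 ?mulr1 => [|i _]; last first.
        by rewrite inE implybb.
      under eq_Ex do rewrite mulrC; rewrite ExZ Ex_sub2 mulrC /t.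
      by apply: ler_pM; rewrite ?exprn_ge0 ?copyU_weight.
    apply: sumr_ge0 => O _; rewrite mulr_ge0 // prodr_ge0 // => i _; by case: ifP.
  apply: sumr_ge0 => O _; rewrite mulr_ge0 // prodr_ge0 // => i _; by case: ifP.
rewrite exchange_big; apply: ler_sum => O _; rewrite -mulr_sumr ler_wpM2l //.
rewrite -(bigA_distr_bigA (fun i j => if (i \in O) ==> (j \in codom s') then 1 else 0)) /=.
apply: ler_prod => i _; rewrite sumr_ge0 /= => [|j _]; last by case: ifP.
case: (i \in O) => /=; last by rewrite sumr_const card_ord.
rewrite -big_mkcond /= sumr_const ler_nat (leq_trans (card_size _)) //.
by rewrite size_map -cardE card_ord.
Qed.

End Copies.

Lemma ler_sum_inj (R : numDomainType) (I J : finType) (h : I -> J)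
    (P : pred I) (Q : pred J) (F : J -> R) :
  {in P &, injective h} -> (forall i, P i -> Q (h i)) -> (forall j, 0 <= F j) ->
  \sum_(i | P i) F (h i) <= \sum_(j | Q j) F j.
Proof.
move=> hinj PQ F0; rewrite -(big_imset _ hinj) /=.
rewrite [X in _ <= X](bigID (fun j => j \in h @: P)) /= -[X in X <= _]addr0 lerD ?sumr_ge0 //.
rewrite [X in X <= _]big_mkcond [X in _ <= X]big_mkcond; apply: ler_sum => j _.
case: ifP => [/imsetP[i Pi ->]|_]; last by case: ifP.
by rewrite PQ // imset_f.
Qed.

Lemma prodr_ord5 (R : pzRingType) (F : 'I_5 -> R) : \prod_i F i =
  F (@Ordinal 5 0 isT) * F (@Ordinal 5 1 isT) * F (@Ordinal 5 2 isT) *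
  F (@Ordinal 5 3 isT) * F (@Ordinal 5 4 isT).
Proof.
rewrite !big_ord_recl big_ord0 mulr1 !mulrA.
by do ![congr (_ * _)]; congr F; apply: val_inj.
Qed.

Lemma prodr_ord6 (R : pzRingType) (F : 'I_6 -> R) : \prod_i F i =
  F (@Ordinal 6 0 isT) * F (@Ordinal 6 1 isT) * F (@Ordinal 6 2 isT) *
  F (@Ordinal 6 3 isT) * F (@Ordinal 6 4 isT) * F (@Ordinal 6 5 isT).
Proof.
rewrite !big_ord_recl big_ord0 mulr1 !mulrA.
by do ![congr (_ * _)]; congr F; apply: val_inj.
Qed.

(** * Expected squares of degrees and of configuration counts *)

Section Counts.
Variables (R : realType) (n : nat).
Implicit Types (p q : R) (G : graph n).
Local Notation V := 'I_n.

Lemma card_edge : (#|edge n| <= n ^ 2)%N.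
Proof.
rewrite card_sig -[X in (X <= _)%N]cardsE.
rewrite (_ : [set x | _] = [set A : {set V} | #|A| == 2%N]); last first.
  by apply/setP => A; rewrite !inE.
by rewrite card_draws card_ord bin2; lia.
Qed.

Lemma Ex_card p : 0 <= p <= 1 -> Ex p (fun G => #|G|%:R) <= n%:R ^+ 2 * p.
Proof.
move=> /andP[p0 p1].
rewrite (_ : Ex p _ = Ex p (fun G => \sum_e ([set e] \subset G)%:R)); last first.
  apply: eq_Ex => G; rewrite -sum1_card natr_sum big_mkcond.
  by apply: eq_bigr => e _; rewrite sub1set; case: (e \in G).
rewrite Ex_sum (eq_bigr (fun=> p)) => [|e _]; last by rewrite Ex_sub cards1 expr1.
rewrite sumr_const -[X in X <= _]mulr_natl ler_wpM2r // -natrX ler_nat.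
exact: card_edge.
Qed.

Lemma star_sub G x (W : {set V}) : x \notin W -> (star x W \subset G) = (W \subset nbr G x).
Proof.
move=> xW; apply/idP/subsetP => [h a aW|h].
  rewrite inE; apply: pairs_edges_sub h; last exact: imset_f.
  by apply: contraNneq xW => ->.
apply: sub_pairs_edges => _ /imsetP[a aW ->]; exists x, a; split=> //.
by have := h _ aW; rewrite inE.
Qed.

Lemma Ex_sum_deg2 p : 0 <= p <= 1 -> 1 <= n%:R * p ->
  Ex p (fun G => \sum_x #|nbr G x|%:R ^+ 2) <= 2 * n%:R ^+ 3 * p ^+ 2.
Proof.
move=> p01 np1; have /andP[p0 p1] := p01.
have E2 x y y' : Ex p (fun G => (adj G x y)%:R * (adj G x y')%:R) <=
    p ^+ (y != y').+1.
  case: (boolP (x \in [set y; y'])) => [|xyy].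
    rewrite !inE => xy; rewrite (_ : Ex p _ = 0) ?exprn_ge0 //.
    rewrite -[RHS](Ex_cst n p); apply: eq_Ex => G; case/orP: xy => /eqP <-.
      by case: (boolP (adj G x x)) => [/adj_neq|] /=; rewrite ?eqxx ?mul0r.
    by case: (boolP (adj G x x)) => [/adj_neq|] /=; rewrite ?eqxx ?mulr0.
  rewrite -(cards2 y y') -(card_star_image xyy) -Ex_sub; apply: le_Ex => // G.
  by rewrite star_sub // subUset !sub1set !inE -natrM mulnb.
have -> : Ex p (fun G => \sum_x #|nbr G x|%:R ^+ 2) =
    \sum_x \sum_y \sum_y' Ex p (fun G => (adj G x y)%:R * (adj G x y')%:R).
  rewrite Ex_sum; apply: eq_bigr => x _; under [RHS]eq_bigr do rewrite -Ex_sum.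
  rewrite -Ex_sum; apply: eq_Ex => G.
  have -> : #|nbr G x|%:R = \sum_y ((adj G x y)%:R : R).
    rewrite -sum1_card natr_sum big_mkcond; apply: eq_bigr => y _.
    by rewrite inE; case: (adj G x y).
  by rewrite expr2 big_distrlr.
apply: (@le_trans _ _ (\sum_(x : V) \sum_(y : V) (p + n%:R * p ^+ 2))); last first.
  have N0 : (0 : R) <= n%:R by [].
  rewrite !sumr_const !card_ord -!mulrnA -[X in X <= _]mulr_natl natrM.
  have : 0 <= n%:R ^+ 2 * p * (n%:R * p - 1) by rewrite !mulr_ge0 ?exprn_ge0 ?subr_ge0.
  lra.
apply: ler_sum => x _; apply: ler_sum => y _.
rewrite (bigD1 y) //=; apply: lerD; first by rewrite (le_trans (E2 _ _ _)) // eqxx.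
apply: (@le_trans _ _ (\sum_(y' : V) p ^+ 2)).
  rewrite big_mkcond; apply: ler_sum => y' _; case: ifP => [yy|_]; last exact: exprn_ge0.
  by rewrite (le_trans (E2 _ _ _)) // eq_sym yy.
by rewrite sumr_const card_ord mulr_natl.
Qed.

Definition conf G x y t a b : bool :=
  [&& uniq [:: x; y; t; a; b], adj G x y, adj G x t, adj G y t, adj G x a & adj G y b].

Definition confs G a b : {set V * V * V} := [set u | conf G u.1.1 u.1.2 u.2 a b].

(** The triangle [x y t] with pendant edges [x a] and [y b]; positions 0 to 4 stand for [x], [y],
    [t], [a], [b]. *)
Definition conf_pattern : seq ('I_5 * 'I_5) :=
  [:: (@Ordinal 5 0 isT, @Ordinal 5 1 isT); (@Ordinal 5 0 isT, @Ordinal 5 2 isT);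
      (@Ordinal 5 1 isT, @Ordinal 5 2 isT); (@Ordinal 5 0 isT, @Ordinal 5 3 isT);
      (@Ordinal 5 1 isT, @Ordinal 5 4 isT)].

Definition ffun_tuple k (l : k.-tuple V) : {ffun 'I_k -> V} := [ffun i => tnth l i].

Lemma ffun_tuple_inj k : injective (@ffun_tuple k).
Proof.
by move=> l l' /ffunP h; apply: eq_from_tnth => i; have := h i; rewrite !ffunE.
Qed.

Lemma ffun_tuple_injective k (l : k.-tuple V) : uniq l -> injective (ffun_tuple l).
Proof. by move=> /tuple_uniqP h i j; rewrite !ffunE => /h. Qed.

(** The square counts pairs of configurations with the same [a] and [b], so the overlap contains
    positions 3 and 4. Overlap in these two alone gives [n ^ 3 * p ^ 5], full overlap gives 1, and
    the hypotheses on [n * p] and [n * p ^ 2] reduce the other cases to these. The factor is [2 ^ 5]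
    overlaps times [5 ^ 5]. *)
Lemma Ex_confs2 p : 0 <= p <= 1 -> 1 <= n%:R * p -> n%:R * p ^+ 2 <= 1 ->
  Ex p (fun G => \sum_a \sum_b #|confs G a b|%:R ^+ 2) <=
  10 ^+ 5 * (n%:R ^+ 5 * p ^+ 5 * (n%:R ^+ 3 * p ^+ 5 + 1)).
Proof.
move=> p01 np1 np2; have /andP[p0 p1] := p01.
pose P (O : {set 'I_5}) := (@Ordinal 5 3 isT \in O) && (@Ordinal 5 4 isT \in O).
have s5 : simple conf_pattern by [].
have s0 : simple ([::] : seq ('I_5 * 'I_5)) by [].
have one01 : 0 <= (1 : R) <= 1 by rewrite ler01 lexx.
apply: le_trans (le_trans (Ex_copy_pairs n P p01 one01 s5 s0) _).
  apply: le_Ex => // G; rewrite [X in _ <= X]pair_big_dep /=.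
  under [X in _ <= X]eq_bigr do rewrite expr1n mulr1.
  have -> : \sum_a \sum_b (#|confs G a b|%:R : R) ^+ 2 =
      \sum_(v : (V * V) * ((V * V * V) * (V * V * V)) |
        (v.2.1 \in confs G v.1.1 v.1.2) && (v.2.2 \in confs G v.1.1 v.1.2)) 1.
    rewrite pair_big /=.
    under eq_bigr => ab _.
      rewrite -sum1_card natr_sum expr2 big_distrlr /=.
      under eq_bigr do under eq_bigr do rewrite mulr1.
      rewrite pair_big /=; over.
    by rewrite pair_big_dep.
  pose mk (ab : V * V) (u : V * V * V) :=
    ffun_tuple [tuple u.1.1; u.1.2; u.2; ab.1; ab.2].
  pose h (v : (V * V) * ((V * V * V) * (V * V * V))) := (mk v.1 v.2.1, mk v.1 v.2.2).
  have cp ab u : u \in confs G ab.1 ab.2 ->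
      injective (mk ab u) /\ copy conf_pattern (mk ab u) \subset G.
    rewrite inE => /and5P[un a1 a2 a3 /andP[a4 a5]]; split.
      exact: ffun_tuple_injective.
    apply: sub_pairs_edges => _ /imsetP[l lL ->].
    move: lL; rewrite !inE => /orP[|/orP[|/orP[|/orP[|]]]] /eqP -> /=;
    rewrite !ffunE !(tnth_nth u.2) /=; eexists; eexists; split; try reflexivity; done.
  apply: le_trans (@ler_sum_inj R _ _ h _
     (fun ss => injectiveb ss.1 && (injectiveb ss.2 && P (overlap ss.2 ss.1)))
     (fun ss => (copy conf_pattern ss.2 \subset G)%:R * (copy conf_pattern ss.1 \subset G)%:R) _ _ _).
  - apply: ler_sum => -[[a b] [u u']] /= /andP[ua ub].
    by rewrite !(proj2 (cp (a, b) _ _)) ?mulr1.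
  - move=> [[a b] [[[x y] t] [[x' y'] t']]] [[c d] [[[u v] r] [[u' v'] r']]] _ _ e.
    have /ffun_tuple_inj/(congr1 val)/= [-> -> -> -> ->] := congr1 fst e.
    by have /ffun_tuple_inj/(congr1 val)/= [-> -> -> _ _] := congr1 snd e.
  - move=> [[a b] [u u']] /= /andP[ua ub].
    have /injectiveP -> := (proj1 (cp (a, b) _ ua)).
    have /injectiveP -> := (proj1 (cp (a, b) _ ub)).
    rewrite /P !inE /=; apply/andP; split.
      rewrite (_ : mk _ _ _ = mk (a, b) u (@Ordinal 5 3 isT)) ?codom_f //.
      by rewrite !ffunE !(tnth_nth a).
    rewrite (_ : mk _ _ _ = mk (a, b) u (@Ordinal 5 4 isT)) ?codom_f //.
    by rewrite !ffunE !(tnth_nth a).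
  - by move=> j; rewrite mulr_ge0.
rewrite /= mulr1.
have N1 : 1 <= n%:R :> R by apply: le_trans np1 _; rewrite ler_piMr.
set N : R := n%:R in np1 np2 N1 *.
have bd O : P O -> (\prod_i (if i \in O then 5 else N)) * outer_weight p conf_pattern O *
    outer_weight 1 ([::] : seq ('I_5 * 'I_5)) O <= 5 ^+ 5 * (N ^+ 3 * p ^+ 5 + 1).
  move=> /andP[i3 i4]; rewrite prodr_ord5 /outer_weight !big_cons !big_nil /= i3 i4 !andbT.
  have A0 : 0 <= N ^+ 3 * p ^+ 5 by rewrite mulr_ge0 ?exprn_ge0 //; lra.
  have h1 : N ^+ 2 * p ^+ 4 <= N ^+ 3 * p ^+ 5.
    have : 0 <= N ^+ 2 * p ^+ 4 * (N * p - 1).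
      by rewrite !mulr_ge0 ?exprn_ge0 ?subr_ge0 //; lra.
    lra.
  have h2 : N ^+ 2 * p ^+ 5 <= N ^+ 3 * p ^+ 5.
    have : 0 <= N ^+ 2 * p ^+ 5 * (N - 1).
      by rewrite !mulr_ge0 ?exprn_ge0 ?subr_ge0 //; lra.
    lra.
  have h3 : N * p ^+ 3 <= 1 by nra.
  case: (Ordinal _ \in O); case: (Ordinal _ \in O); case: (Ordinal _ \in O) => /=; lra.
have N0 : 0 <= N by [].
rewrite [X in _ <= X](_ : _ = N ^+ 5 * p ^+ 5 * (10 ^+ 5 * (N ^+ 3 * p ^+ 5 + 1))); last by ring.
apply: ler_wpM2l; first by rewrite mulr_ge0 ?exprn_ge0.
apply: (@le_trans _ _ (\sum_(O : {set 'I_5}) 5 ^+ 5 * (N ^+ 3 * p ^+ 5 + 1))).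
  rewrite big_mkcond; apply: ler_sum => O _; case: ifP => [/bd|_] //.
  by rewrite mulr_ge0 ?addr_ge0 ?mulr_ge0 ?exprn_ge0.
rewrite sumr_const (_ : #|_| = 32%N); last first.
  by rewrite -cardsT -powersetT card_powerset cardsT card_ord.
have A0 : 0 <= N ^+ 3 * p ^+ 5 by rewrite mulr_ge0 ?exprn_ge0.
rewrite -mulr_natr; lra.
Qed.

End Counts.

Lemma ler_sum_term (R : numDomainType) (I : finType) (P : pred I) (F : I -> R) i :
  P i -> (forall j, 0 <= F j) -> F i <= \sum_(j | P j) F j.
Proof. by move=> Pi F0; rewrite (bigD1 i) //= lerDl sumr_ge0. Qed.

(** * Edges and triangles in all large sets *)

Section Pseudorandom.
Variables (R : realType) (n : nat).
Implicit Types (p : R) (G : graph n) (Y : {set 'I_n}).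
Local Notation V := 'I_n.

Lemma star_neighbourhood_chebyshev p v (I : finType) (Q : pred I) (W : I -> {set V})
    (mu : R) :
  0 <= p <= 1 -> (forall i, Q i -> v \notin W i) -> mu = \sum_(i | Q i) p ^+ #|W i| ->
  Ex p (fun G => (\sum_(i | Q i) (W i \subset nbr G v)%:R < mu / 2)%R%:R) * mu ^+ 2 <=
  4 * \sum_(i | Q i) \sum_(j | Q j && ~~ [disjoint W i & W j]) p ^+ #|W i :|: W j|.
Proof.
move=> p01 vW ->; have /andP[p0 p1] := p01.
have -> : \sum_(i | Q i) p ^+ #|W i| = \sum_(i | Q i) p ^+ #|star v (W i)|.
  by apply: eq_bigr => i /vW vi; rewrite card_star_image.
set m := \sum_(i | Q i) p ^+ _.
have -> : Ex p (fun G => (\sum_(i | Q i) (W i \subset nbr G v)%:R < m / 2)%R%:R) =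
  Ex p (fun G => (\sum_(i | Q i) (star v (W i) \subset G)%:R < m / 2)%R%:R).
  apply: eq_Ex => G; rewrite (eq_bigr (fun i => (star v (W i) \subset G)%:R)) //.
  by move=> i /vW vi; rewrite star_sub.
apply: le_trans (chebyshev_sub Q (fun i => star v (W i)) p01) _.
rewrite ler_wpM2l //; apply: ler_sum => i /vW vi.
rewrite [X in X <= _]big_mkcond [X in _ <= X]big_mkcond; apply: ler_sum => j _.
case: (boolP (Q j)) => //= /vW vj.
case: ifP => [dS|_]; last by case: ifP => // _; apply: exprn_ge0.
have -> : ~~ [disjoint W i & W j].
  apply: contra dS => /setDidPl dW; rewrite disjoints_subset; apply/subsetP => e.
  rewrite !inE => /imsetP[a ai ->]; apply/imsetP => -[b bj] /setP /(_ a).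
  rewrite !inE eqxx orbT => /esym/orP[/eqP av|/eqP ab].
    by rewrite -av ai in vi.
  by move: ai; rewrite -dW inE ab bj.
rewrite -(@card_star_image _ v (W i :|: W j)) ?in_setU ?negb_or ?vi //.
rewrite (_ : star v (_ :|: _) = star v (W i) :|: star v (W j)) //.
by apply/setP => e; rewrite !inE imsetU inE.
Qed.

Definition dense_pairs p (eta : R) G : bool :=
  [forall Y1 : {set V}, forall Y2 : {set V},
    [&& [disjoint Y1 & Y2], eta * n%:R <= #|Y1|%:R & eta * n%:R <= #|Y2|%:R] ==>
    (p * #|Y1|%:R * #|Y2|%:R / 4 <= \sum_(v in Y2) #|nbr G v :&: Y1|%:R)].

Definition triangles G Y1 Y2 Y3 : {set V * V * V} :=
  [set u | [&& u.1.1 \in Y1, u.1.2 \in Y2, u.2 \in Y3, adj G u.1.1 u.1.2,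
               adj G u.1.1 u.2 & adj G u.1.2 u.2]].

(** The 16 is 4 from [dense_pairs], times 2 for half of the expected number at a vertex of [Y3],
    times 2 for half of the vertices of [Y3]. *)
Definition rich_triangles p (eta : R) G : bool :=
  [forall Y1 : {set V}, forall Y2 : {set V}, forall Y3 : {set V},
    [&& [disjoint Y1 & Y2], [disjoint Y1 & Y3], [disjoint Y2 & Y3],
        eta * n%:R <= #|Y1|%:R, eta * n%:R <= #|Y2|%:R & eta * n%:R <= #|Y3|%:R] ==>
    (eta ^+ 3 * n%:R ^+ 3 * p ^+ 3 / 16 <= #|triangles G Y1 Y2 Y3|%:R)].

Lemma half_sum_lb Y (f : V -> R) (c : R) : 0 <= c -> (forall v, 0 <= f v) ->
  #|[set v in Y | (f v < c)%R]|%:R < (#|Y|%:R / 2 : R) ->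
  #|Y|%:R * c / 2 <= \sum_(v in Y) f v.
Proof.
move=> c0 f0 hY; rewrite (bigID (fun v => f v < c)) /=.
rewrite -[X in X <= _]add0r; apply: lerD; first exact: sumr_ge0.
apply: (@le_trans _ _ (\sum_(v in Y :\: [set v in Y | (f v < c)%R]) c)).
  rewrite sumr_const -[X in _ <= X]mulr_natl.
  have : (#|Y| <= #|[set v in Y | (f v < c)%R]| + #|Y :\: [set v in Y | (f v < c)%R]|)%N.
    by rewrite -[X in (X <= _)%N](cardsID [set v in Y | (f v < c)%R] Y) leq_add2r subset_leq_card ?subsetIr.
  rewrite -(ler_nat R) natrD; nra.
rewrite [X in X <= _]big_mkcond [X in _ <= X]big_mkcond; apply: ler_sum => v _.
rewrite !inE; case: (boolP (v \in Y)) => //= _; rewrite ?andbF ?andbT.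
by rewrite -leNgt; case: ifP.
Qed.

Lemma expR_two k : (2 : R) ^+ k <= expR k%:R.
Proof.
rewrite -[k%:R]mulr1 expRM_natl; apply: lerXn2r; rewrite ?nnegrE ?expR_ge0 //.
by apply: le_trans (expR_ge1Dx 1); lra.
Qed.

Lemma sum_sets_cst (c : R) : \sum_(Y : {set V}) c = 2 ^+ n * c.
Proof.
rewrite sumr_const (_ : #|_| = (2 ^ n)%N); first by rewrite -[LHS]mulr_natl natrX.
by rewrite -cardsT -powersetT card_powerset cardsT card_ord.
Qed.

(** By Chebyshev's inequality a vertex of [Y2] has fewer than half of the expected neighbours in
    [Y1] with probability at most [expR (- (8 / eta))]. By independence of the rows, half of [Y2] is
    like this with probability at most [2 ^+ n * expR (- (4 * n%:R))], which beats the [4 ^ n]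
    choices of [Y1] and [Y2]. *)
Lemma not_dense_pairs p eta : 0 <= p <= 1 -> 0 < eta ->
  4 * expR (8 / eta) <= eta * (n%:R * p) ->
  Ex p (fun G => (~~ dense_pairs p eta G)%:R) <= expR (- n%:R).
Proof.
move=> p01 eta0 hM; have /andP[p0 p1] := p01.
pose bad Y1 Y2 G : R := (#|Y2|%:R / 2 <=
  #|[set v in Y2 | (#|(nbr G v :&: Y1) :&: Y1|%:R < p * #|Y1|%:R / 2 :> R)%R]|%:R :> R)%R%:R.
apply: (@le_trans _ _ (\sum_(Y1 : {set V}) \sum_(Y2 : {set V} |
  [&& [disjoint Y1 & Y2], eta * n%:R <= #|Y1|%:R & eta * n%:R <= #|Y2|%:R])
    Ex p (bad Y1 Y2))).
  under eq_bigr do rewrite -Ex_sum; rewrite -Ex_sum; apply: le_Ex => // G.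
  have t0 Y1 Y2 : 0 <= bad Y1 Y2 G by [].
  case: (boolP (dense_pairs p eta G)) => [_|] /=.
    by apply: sumr_ge0 => *; apply: sumr_ge0.
  rewrite negb_forall => /existsP[Y1]; rewrite negb_forall => /existsP[Y2].
  rewrite negb_imply => /andP[Y12 nd].
  have h1 : 1 <= bad Y1 Y2 G.
    rewrite /bad; case: (boolP (_ <= #|[set v in Y2 | _]|%:R)) => //=.
    rewrite -ltNge => h; case/negP: nd.
    have := half_sum_lb _ _ h; rewrite mulr_ge0 ?mulr_ge0 // => /(_ isT (fun=> ler0n _ _)).
    under eq_bigr do rewrite -setIA setIid; lra.
  apply: le_trans h1 _; rewrite (bigD1 Y1) //= (bigD1 Y2) //= -addrA lerDl.
  by rewrite addr_ge0 ?sumr_ge0 // => *; apply: sumr_ge0.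
pose b := 8 / eta.
have b0 : 0 <= b by rewrite divr_ge0 // ltW.
apply: (@le_trans _ _ (\sum_(Y1 : {set V}) \sum_(Y2 : {set V}) 2 ^+ n * expR (- (4 * n%:R)))).
  apply: ler_sum => Y1 _; rewrite big_mkcond; apply: ler_sum => Y2 _; case: ifP; last first.
    by move=> _; rewrite mulr_ge0 ?exprn_ge0 ?expR_ge0.
  move=> /and3P[d12 Y1n Y2n].
  rewrite disjoint_sym in d12.
  apply: le_trans (rows_tail (n := n) (p := p) (b := b) _
    (B := fun v N => (#|N :&: Y1|%:R < p * #|Y1|%:R / 2 :> R)%R) p01 d12 b0 _) _; last first.
    rewrite ler_wpM2l ?exprn_ge0 // ler_expR lerN2 /b.
    have := ler_wpM2l (_ : 0 <= 4 / eta) Y2n; rewrite divr_ge0 ?(ltW eta0) // => /(_ isT).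
    rewrite mulrA divfK ?gt_eqF //; lra.
  move=> v vY2.
  have vY1 : v \notin Y1 by rewrite (disjointFr d12 vY2).
  have muE : p * #|Y1|%:R = \sum_(i in Y1) p ^+ #|[set i]|.
    under eq_bigr do rewrite cards1 expr1.
    by rewrite sumr_const -[RHS]mulr_natr.
  have vn i : i \in Y1 -> v \notin [set i].
    by move=> iY; rewrite inE; apply: contraNneq vY1 => ->.
  have := star_neighbourhood_chebyshev p01 vn muE.
  have -> : \sum_(i in Y1) \sum_(j | (j \in Y1) && ~~ [disjoint [set i] & [set j]])
      p ^+ #|[set i] :|: [set j]| = p * #|Y1|%:R.
    rewrite mulr_natr -sumr_const; apply: eq_bigr => i iY.
    rewrite (big_pred1 i) ?setUid ?cards1 ?expr1 // => j; rewrite disjoints1 inE negbK.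
    by rewrite [i == j]eq_sym /=; case: eqP => [->|_]; rewrite ?iY ?andbF.
  have -> : Ex p (fun G => (#|(nbr G v :&: Y1) :&: Y1|%:R < p * #|Y1|%:R / 2 :> R)%R%:R) =
    Ex p (fun G => (\sum_(i in Y1) ([set i] \subset nbr G v)%:R < p * #|Y1|%:R / 2)%R%:R).
    apply: eq_Ex => G; do 2 congr (_ _); congr (_ < _).
    rewrite -setIA setIid -sum1_card natr_sum big_mkcond [RHS]big_mkcond.
    by apply: eq_bigr => i _; rewrite !inE sub1set !inE; case: (adj G v i); case: (i \in Y1).
  have mub : 4 * expR b <= p * #|Y1|%:R.
    apply: le_trans hM _; rewrite mulrA [X in _ <= X]mulrC ler_wpM2r //.
  have : 0 <= Ex p (fun G => (\sum_(i in Y1) ([set i] \subset nbr G v)%:R <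
      p * #|Y1|%:R / 2)%R%:R) by exact: Ex_ge0.
  move: mub; move: (p * _) => mu mub; move: (Ex p _) => P P0 hP.
  have e0 := expR_gt0 b; have mu0 : 0 < mu by lra.
  have Pmu : P * mu <= 4 by rewrite -(ler_pM2r mu0); lra.
  rewrite expRN -[X in _ <= X]mul1r ler_pdivlMr //.
  have : 0 <= P * (mu - 4 * expR b) by rewrite mulr_ge0 ?subr_ge0.
  lra.
rewrite !sum_sets_cst.
have e2 := expR_two n; have e0 : 0 <= (2 : R) ^+ n by rewrite exprn_ge0.
have -> : expR (- n%:R) = expR n%:R * (expR n%:R * (expR n%:R * expR (- (4 * n%:R)))) :> R.
  rewrite -!expRD; congr expR; ring.
by do 2 (rewrite ler_pM ?mulr_ge0 ?expR_ge0 //); rewrite ler_wpM2r ?expR_ge0.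
Qed.

Definition edges_between G Y1 Y2 : pred (V * V) :=
  fun y => [&& y.1 \in Y1, y.2 \in Y2 & adj G y.1 y.2].

Definition edge_count G Y1 Y2 : R := \sum_(y | edges_between G Y1 Y2 y) 1.

Lemma card_nbr_sum G x : #|nbr G x|%:R = \sum_y ((adj G x y)%:R : R).
Proof.
rewrite -sum1_card natr_sum big_mkcond; apply: eq_bigr => y _.
by rewrite inE; case: (adj G x y).
Qed.

Lemma edge_countE G Y1 Y2 : edge_count G Y1 Y2 = \sum_(v in Y2) #|nbr G v :&: Y1|%:R.
Proof.
rewrite /edge_count (eq_bigl (fun y => predT y.1 && edges_between G Y1 Y2 (y.1, y.2))).
  rewrite -(pair_big_dep predT (fun x y => edges_between G Y1 Y2 (x, y)) (fun _ _ => 1)) /=.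
  rewrite (exchange_big_dep (mem Y2)) /= => [|x y _ /and3P[]] //.
  apply: eq_bigr => y y2; rewrite -sum1_card natr_sum; apply: eq_bigl => x.
  by rewrite /edges_between /= y2 !inE adjC andbC.
by case.
Qed.

(** Two edges with a common end are counted by the squared degree of that end; the 2 accounts for
    the side on which it lies. These are the correlated pairs in the variance below. *)
Lemma sum_common_end G Y1 Y2 :
  \sum_(y | edges_between G Y1 Y2 y) \sum_(z | edges_between G Y1 Y2 z)
    ((y.1 == z.1)%:R + (y.2 == z.2)%:R) <= 2 * \sum_x #|nbr G x|%:R ^+ 2 :> R.
Proof.
pose A (y : V * V) : R := (adj G y.1 y.2)%:R.
apply: (@le_trans _ _ (\sum_(y : V * V) \sum_(z : V * V)
    A y * A z * ((y.1 == z.1)%:R + (y.2 == z.2)%:R))).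
  rewrite big_mkcond; apply: ler_sum => y _; case: ifP => [/and3P[_ _ ay]|_]; last first.
    by apply: sumr_ge0 => z _; rewrite mulr_ge0 ?addr_ge0 // mulr_ge0 /A.
  rewrite big_mkcond; apply: ler_sum => z _; case: ifP => [/and3P[_ _ az]|_].
    by rewrite /A ay az !mul1r.
  by rewrite mulr_ge0 ?addr_ge0 // mulr_ge0 /A.
have -> : \sum_(y : V * V) \sum_(z : V * V) A y * A z * ((y.1 == z.1)%:R + (y.2 == z.2)%:R) =
   \sum_(y : V * V) \sum_(z : V * V | z.1 == y.1) A y * A z +
   \sum_(y : V * V) \sum_(z : V * V | z.2 == y.2) A y * A z.
  rewrite -big_split; apply: eq_bigr => y _ /=.
  rewrite [X in _ = X + _]big_mkcond [X in _ = _ + X]big_mkcond -big_split.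
  apply: eq_bigr => z _ /=; rewrite mulrDr [z.1 == _]eq_sym [z.2 == _]eq_sym.
  by case: (y.1 == z.1); case: (y.2 == z.2); rewrite ?mulr1 ?mulr0.
have eq_leR (a b : R) : a = b -> a <= b by move=> ->.
rewrite mulr_natl mulr2n; apply: lerD; apply: eq_leR.
  rewrite -(pair_big predT predT (fun x b => \sum_(z | z.1 == x) A (x, b) * A z)) /=.
  apply: eq_bigr => x _; rewrite card_nbr_sum expr2 big_distrlr /=; apply: eq_bigr => b _.
  rewrite (eq_bigl (fun z => pred1 x z.1 && predT z.2)) => [|z]; last by rewrite andbT.
  rewrite -(pair_big (pred1 x) predT (fun x' b' => A (x, b) * A (x', b'))) /=.
  by rewrite big_pred1_eq.
rewrite -(pair_big predT predT (fun b x => \sum_(z | z.2 == x) A (b, x) * A z)) /=.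
rewrite exchange_big; apply: eq_bigr => x _.
rewrite card_nbr_sum expr2 big_distrlr /=; apply: eq_bigr => b _.
rewrite (eq_bigl (fun z => predT z.1 && pred1 x z.2)) //.
rewrite -(pair_big predT (pred1 x) (fun b' x' => A (b, x) * A (b', x'))) /=.
apply: eq_bigr => b' _; rewrite big_pred1_eq /A /=.
by rewrite adjC [adj G b' x]adjC.
Qed.

(** The edges between [Y1] and [Y2] are fixed, only the neighbourhood of [v] is random. Distinct
    correlated edges share exactly one end, so [v] has to be joined to three vertices, with
    probability [p ^+ 3]. *)
Lemma triangle_row p G Y1 Y2 v : 0 <= p <= 1 -> [disjoint Y1 & Y2] ->
  v \notin Y1 -> v \notin Y2 ->
  Ex p (fun H => (\sum_(y | edges_between G Y1 Y2 y)
     ([set y.1; y.2] \subset nbr H v)%:R < p ^+ 2 * edge_count G Y1 Y2 / 2)%R%:R) * (p ^+ 2 * edge_count G Y1 Y2) ^+ 2 <=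
  4 * (p ^+ 2 * edge_count G Y1 Y2 + 2 * p ^+ 3 * \sum_x #|nbr G x|%:R ^+ 2).
Proof.
move=> p01 d12 vY1 vY2; have /andP[p0 p1] := p01.
set Q := edges_between G Y1 Y2.
have W2 y : Q y -> #|[set y.1; y.2]| = 2%N.
  by move=> /and3P[_ _ /adj_neq y12]; rewrite cards2 y12.
have muE : p ^+ 2 * edge_count G Y1 Y2 = \sum_(y | Q y) p ^+ #|[set y.1; y.2]|.
  by rewrite mulr_sumr; apply: eq_bigr => y /W2->; rewrite mulr1.
have vn y : Q y -> v \notin [set y.1; y.2].
  move=> /and3P[y1 y2 _]; rewrite !inE negb_or.
  by rewrite (contraNneq _ vY1) ?(contraNneq _ vY2) // => ->.
apply: le_trans (star_neighbourhood_chebyshev p01 vn muE) _; rewrite ler_wpM2l //.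
apply: (@le_trans _ _ (\sum_(y | Q y) (p ^+ 2 + p ^+ 3 *
    \sum_(z | Q z) ((y.1 == z.1)%:R + (y.2 == z.2)%:R)))); last first.
  rewrite big_split /=; apply: lerD.
    by rewrite /edge_count mulr_sumr; apply: ler_sum => y _; rewrite mulr1.
  rewrite -mulr_sumr; apply: le_trans (ler_wpM2l _ (sum_common_end _ _ _)) _.
    exact: exprn_ge0.
  by rewrite mulrCA mulrA.
apply: ler_sum => y Qy; have [y1 y2 ay] := and3P Qy.
rewrite (bigD1 y) /=; last by rewrite Qy -setI_eq0 setIid -cards_eq0 W2.
rewrite setUid W2 // lerD2l mulr_sumr.
rewrite big_mkcond [X in _ <= X]big_mkcond; apply: ler_sum => z _.
case: (boolP (Q z)) => //= Qz; have [z1 z2 az] := and3P Qz.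
case: ifP => [/andP[dW zy]|_]; last by rewrite mulr_ge0 ?addr_ge0 ?exprn_ge0.
have y1z2 : y.1 != z.2 by apply: contraTneq y1 => ->; rewrite (disjointFl d12 z2).
have z1y2 : z.1 != y.2 by apply: contraTneq z1 => ->; rewrite (disjointFl d12 y2).
have card3 : (3 <= #|[set y.1; y.2] :|: [set z.1; z.2]|)%N.
  have zW : [set y.1; y.2] != [set z.1; z.2].
    apply: contra zy => /eqP/setP E; have := E y.1; have := E y.2.
    rewrite !inE !eqxx orbT (negbTE y1z2) orbF [y.2 == z.1]eq_sym (negbTE z1y2) /=.
    move=> /esym/eqP e2 /esym/eqP e1; case: (y) (z) e1 e2 => [a b] [c d] /= -> ->.
    exact: eqxx.
  rewrite -(W2 y Qy); apply: proper_card; rewrite properE subsetUl /= subUset subxx /=.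
  by apply: contra zW => sub; rewrite eq_sym eqEcard sub !W2.
have -> : (y.1 == z.1)%:R + (y.2 == z.2)%:R = 1 :> R.
  move: dW; rewrite -setI_eq0 => /set0Pn[u]; rewrite !inE => /andP[h1 h2].
  case: (eqVneq y.1 z.1) => e1; case: (eqVneq y.2 z.2) => e2; rewrite ?addr0 ?add0r //.
    case/negP: zy; apply/eqP; case: (y) (z) e1 e2 => [a b] [c d] /= -> ->.
    by [].
  move: h1 h2 => /orP[]/eqP-> /orP[]/eqP h; move: y1z2 z1y2 e1 e2; rewrite h ?eqxx //.
by rewrite mulr1; apply: ler_wiXn2l.
Qed.

(** With [X = N ^+ 2 * p ^+ 3], the mean [f] is at least of order [X]. The two variance terms give
    [P * X <= K]: the first directly, the second because the bound on [D] and [N * p ^+ 2 <= 1] make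
    [p ^+ 3 * D * X] at most of order [f ^+ 2]. *)
Lemma chebyshev_ratio (N p eta C P e D E : R) :
  0 <= p -> 0 <= N -> 0 < eta -> 0 <= C -> 0 <= P -> 0 < E -> N * p ^+ 2 <= 1 ->
  E * (16 / eta ^+ 2 + 128 * C / eta ^+ 4) <= N ^+ 2 * p ^+ 3 ->
  p * (eta * N) ^+ 2 / 4 <= e ->
  P * (p ^+ 2 * e) ^+ 2 <= 4 * (p ^+ 2 * e + 2 * p ^+ 3 * D) ->
  D <= C * (N ^+ 3 * p ^+ 2) -> P <= E^-1.
Proof.
move=> p0 N0 eta0 C0 P0 E0 np2 hE he hP hD.
have [e2 e4] : 0 < eta ^+ 2 /\ 0 < eta ^+ 4 by rewrite !exprn_gt0.
set K := (X in E * X) in hE; set X := N ^+ 2 * p ^+ 3 in hE.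
have K0 : 0 < K by apply: ltr_pwDl; rewrite ?divr_gt0 // divr_ge0 ?mulr_ge0 // ltW.
have X0 : 0 < X by apply: lt_le_trans hE; rewrite mulr_gt0.
set f := p ^+ 2 * e in hP.
have fX : eta ^+ 2 * X / 4 <= f.
  by have := ler_wpM2l (exprn_ge0 2 p0) he; rewrite /f /X; lra.
have f0 : 0 < f by apply: lt_le_trans fX; apply: divr_gt0 => //; exact: mulr_gt0.
have Xf : X <= 4 * f / eta ^+ 2 by rewrite ler_pdivlMr //; lra.
have DX : p ^+ 3 * D * X <= 16 * C * f ^+ 2 / eta ^+ 4.
  have h1 : p ^+ 3 * D * X <= C * (N ^+ 5 * p ^+ 8).
    have := ler_wpM2l (_ : 0 <= p ^+ 3 * X) hD.
    by rewrite mulr_ge0 ?exprn_ge0 ?(ltW X0) // => /(_ isT); rewrite /X; lra.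
  have h2 : N ^+ 5 * p ^+ 8 <= X ^+ 2.
    have : 0 <= N ^+ 4 * p ^+ 6 * (1 - N * p ^+ 2).
      by rewrite !mulr_ge0 ?exprn_ge0 ?subr_ge0.
    by rewrite /X; lra.
  have h3 : eta ^+ 4 * X ^+ 2 <= 16 * f ^+ 2.
    have : (eta ^+ 2 * X / 4) ^+ 2 <= f ^+ 2.
      by apply: lerXn2r fX; rewrite nnegrE; [apply: divr_ge0 => //; apply: mulr_ge0|]; exact: ltW.
    lra.
  have h4 : X ^+ 2 <= 16 * f ^+ 2 / eta ^+ 4 by rewrite ler_pdivlMr //; lra.
  apply: le_trans h1 _; have := ler_wpM2l C0 (le_trans h2 h4); lra.
have f20 : 0 < f ^+ 2 by rewrite exprn_gt0.
have PX : P * X <= K.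
  rewrite -(ler_pM2r f20); have h1 := ler_wpM2r (ltW X0) hP.
  have h2 := ler_wpM2l (ltW f0) Xf; rewrite /K; lra.
rewrite -[X in _ <= X]mul1r ler_pdivlMr // -(ler_pM2r K0) mul1r.
apply: le_trans PX; rewrite -mulrA; exact: ler_wpM2l.
Qed.

(** The pairs between [Y3] and the union of [Y1] and [Y2] are revealed last; the edges between [Y1]
    and [Y2] are then fixed and the rows of [Y3] are independent. A row fails with probability at
    most [expR (- (10 / eta))], so half of them fail with probability at most
    [2 ^+ n * expR (- (5 * n%:R))], against [8 ^ n] triples. There is no further data to choose, so
    the index type is [unit]. *)
Lemma not_rich_triangles p eta C : 0 <= p <= 1 -> 0 < eta -> 0 <= C ->
  n%:R * p ^+ 2 <= 1 ->
  expR (10 / eta) * (16 / eta ^+ 2 + 128 * C / eta ^+ 4) <= n%:R ^+ 2 * p ^+ 3 ->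
  Ex p (fun G => [&& dense_pairs p eta G,
     (\sum_x #|nbr G x|%:R ^+ 2 <= C * (n%:R ^+ 3 * p ^+ 2))%R &
     ~~ rich_triangles p eta G]%:R) <= expR (- n%:R).
Proof.
move=> p01 eta0 C0 np2 hM; have /andP[p0 p1] := p01.
pose e := edge_count.
pose T3 G Y1 Y2 (N : {set V}) : R :=
  \sum_(y | edges_between G Y1 Y2 y) ([set y.1; y.2] \subset N)%:R.
pose J Y1 Y2 G (i : unit) := (p * #|Y1|%:R * #|Y2|%:R / 4 <= e G Y1 Y2) &&
  (\sum_x #|nbr G x|%:R ^+ 2 <= C * (n%:R ^+ 3 * p ^+ 2)).
pose B Y1 Y2 G (i : unit) (v : V) (N : {set V}) :=
  T3 G Y1 Y2 N < p ^+ 2 * e G Y1 Y2 / 2.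
pose bad Y1 Y2 Y3 G := [exists i : unit, J Y1 Y2 (G :\: cross Y3 (Y1 :|: Y2)) i &&
  (#|Y3|%:R / 2 <= (#|[set v in Y3 | B Y1 Y2 (G :\: cross Y3 (Y1 :|: Y2)) i v
      (nbr G v :&: (Y1 :|: Y2))]|%:R : R))].
pose big Y1 Y2 Y3 := [&& [disjoint Y1 & Y2], [disjoint Y1 & Y3], [disjoint Y2 & Y3],
        eta * n%:R <= #|Y1|%:R, eta * n%:R <= #|Y2|%:R & eta * n%:R <= #|Y3|%:R].
apply: (@le_trans _ _ (\sum_(Y1 : {set V}) \sum_(Y2 : {set V}) \sum_(Y3 : {set V} |
  big Y1 Y2 Y3) Ex p (fun G => (bad Y1 Y2 Y3 G)%:R))).
  under eq_bigr do (under eq_bigr do rewrite -Ex_sum); under eq_bigr do rewrite -Ex_sum.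
  rewrite -Ex_sum; apply: le_Ex => // G.
  case: and3P => [[dG CG]|_] /=; last by do 3 (apply: sumr_ge0 => ? _).
  rewrite negb_forall => /existsP[Y1]; rewrite negb_forall => /existsP[Y2].
  rewrite negb_forall => /existsP[Y3]; rewrite negb_imply => /andP[Y123 nr].
  have h1 : bad Y1 Y2 Y3 G.
    have /and5P[d12 d13 d23 Y1n /andP[Y2n Y3n]] := Y123.
    rewrite /bad; set D := cross Y3 _.
    have QE : edges_between (G :\: D) Y1 Y2 =1 edges_between G Y1 Y2.
      move=> [x y]; rewrite /edges_between /=.
      case: (boolP (x \in Y1)) => //= x1; case: (boolP (y \in Y2)) => //= y2.
      apply: eq_adj => f /eqP fE; rewrite in_setD (in_cross _ _ fE).
      by rewrite (disjointFr d13 x1) (disjointFr d23 y2).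
    have eE : e (G :\: D) Y1 Y2 = e G Y1 Y2 by rewrite /e /edge_count (eq_bigl _ _ QE).
    have e_ge : p * #|Y1|%:R * #|Y2|%:R / 4 <= e G Y1 Y2.
      rewrite /e edge_countE; move: dG => /forallP/(_ Y1)/forallP/(_ Y2).
      by rewrite d12 Y1n Y2n.
    apply/existsP; exists tt; apply/andP; split.
      rewrite /J eE e_ge /=; apply: le_trans CG; apply: ler_sum => x _.
      apply: lerXn2r; rewrite ?nnegrE // ler_nat subset_leq_card //.
      by apply/subsetP => y; rewrite !inE; apply: adjS; exact: subsetDl.
    rewrite leNgt; apply/negP => h; case/negP: nr.
    have T30 Y N H : 0 <= T3 H Y1 Y N by apply: sumr_ge0.
    have e0 : 0 <= e G Y1 Y2 by apply: sumr_ge0.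
    have := half_sum_lb (_ : 0 <= p ^+ 2 * e (G :\: D) Y1 Y2 / 2) (fun v => T30 _ _ _) h.
    rewrite eE divr_ge0 ?mulr_ge0 ?exprn_ge0 // => /(_ isT) h2.
    have h3 : \sum_(v in Y3) T3 (G :\: D) Y1 Y2 (nbr G v :&: (Y1 :|: Y2)) <=
        #|triangles G Y1 Y2 Y3|%:R.
      rewrite -sum1_card natr_sum exchange_big /=.
      rewrite [X in _ <= X](eq_bigl (fun u => predT u.1 &&
        ((u.1, u.2) \in triangles G Y1 Y2 Y3))); last by case.
      rewrite -(pair_big_dep predT (fun y v => (y, v) \in triangles G Y1 Y2 Y3)
        (fun y v => 1)) /=.
      rewrite (eq_bigl _ _ QE) big_mkcond; apply: ler_sum => y _.
      case: ifP => [/and3P[y1 y2 ay]|_]; last exact: sumr_ge0.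
      rewrite big_mkcond [X in _ <= X]big_mkcond; apply: ler_sum => v _.
      case: ifP => [v3|_]; last by case: ifP.
      case: (boolP (_ \subset _)) => [|_]; last by case: ifP.
      rewrite subsetI => /andP[yv _]; rewrite inE /= y1 y2 v3 ay /=.
      move: yv; rewrite subUset !sub1set !inE => /andP[a1 a2].
      by rewrite adjC a1 adjC a2.
    have h4 : p * (eta * n%:R) ^+ 2 / 4 <= e G Y1 Y2.
      apply: le_trans e_ge; have en0 : 0 <= eta * n%:R by rewrite mulr_ge0 // ltW.
      by have := ler_wpM2l p0 (ler_pM en0 en0 Y1n Y2n); lra.
    apply: le_trans h3; apply: le_trans h2.
    have en0 : 0 <= eta * n%:R by rewrite mulr_ge0 // ltW.
    have h5 : (eta * n%:R) * (p ^+ 2 * (p * (eta * n%:R) ^+ 2 / 4) / 2) <=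
       #|Y3|%:R * (p ^+ 2 * e G Y1 Y2 / 2).
      apply: ler_pM => //; last by rewrite ler_wpM2r // ler_wpM2l // exprn_ge0.
      by rewrite divr_ge0 // mulr_ge0 ?exprn_ge0 // divr_ge0 // mulr_ge0 ?exprn_ge0.
    lra.
  have t0 Z1 Z2 Z3 : 0 <= (bad Z1 Z2 Z3 G)%:R :> R by [].
  apply: (@le_trans _ _ (bad Y1 Y2 Y3 G)%:R); first by rewrite h1.
  apply: le_trans (@ler_sum_term _ _ (big Y1 Y2) _ Y3 Y123 (t0 Y1 Y2)) _.
  have t1 Z1 Z2 : 0 <= \sum_(Z3 | big Z1 Z2 Z3) (bad Z1 Z2 Z3 G)%:R :> R.
    by apply: sumr_ge0.
  apply: le_trans (@ler_sum_term _ _ predT _ Y2 isT (t1 Y1)) _.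
  apply: (@ler_sum_term _ _ predT
    (fun Z1 => \sum_Z2 \sum_(Z3 | big Z1 Z2 Z3) (bad Z1 Z2 Z3 G)%:R)) => // Z1.
  by apply: sumr_ge0.
pose b := 10 / eta.
have b0 : 0 <= b by rewrite divr_ge0 // ltW.
apply: (@le_trans _ _ (\sum_(Y1 : {set V}) \sum_(Y2 : {set V}) \sum_(Y3 : {set V})
   2 ^+ n * expR (- (5 * n%:R)))).
  apply: ler_sum => Y1 _; apply: ler_sum => Y2 _; rewrite big_mkcond.
  apply: ler_sum => Y3 _; case: ifP; last first.
    by move=> _; rewrite mulr_ge0 ?exprn_ge0 ?expR_ge0.
  move=> /and5P[d12 d13 d23 Y1n /andP[Y2n Y3n]].
  have dM : [disjoint Y3 & Y1 :|: Y2].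
    by rewrite disjoints_subset setCU subsetI -!disjoints_subset ![[disjoint Y3 & _]]disjoint_sym d13.
  apply: le_trans (cond_rows_tail (K := 1) (b := b) (J := J Y1 Y2) (B := B Y1 Y2)
     _ p01 dM b0 _ _) _.
  - move=> G; rewrite (_ : 1 = 1%:R) // ler_nat.
    by rewrite (leq_trans (max_card _)) // card_unit.
  - move=> G i v /andP[eG dG] v3.
    have vY1 : v \notin Y1 by rewrite (disjointFl d13 v3).
    have vY2 : v \notin Y2 by rewrite (disjointFl d23 v3).
    have := triangle_row G p01 d12 vY1 vY2.
    have -> : Ex p (fun H => (B Y1 Y2 G i v (nbr H v :&: (Y1 :|: Y2)))%:R) =
       Ex p (fun H => (\sum_(y | edges_between G Y1 Y2 y)
     ([set y.1; y.2] \subset nbr H v)%:R < p ^+ 2 * edge_count G Y1 Y2 / 2)%R%:R).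
      apply: eq_Ex => H; do 2 congr (_ _); congr (_ < _); apply: eq_bigr => y.
      move=> /and3P[y1 y2 _]; do 2 congr (_ _); rewrite subsetI andbC.
      by rewrite subUset !sub1set !inE y1 y2 orbT.
    have : 0 <= Ex p (fun H => (\sum_(y | edges_between G Y1 Y2 y)
     ([set y.1; y.2] \subset nbr H v)%:R < p ^+ 2 * edge_count G Y1 Y2 / 2)%R%:R).
      exact: Ex_ge0.
    move: (Ex p _) => P P0 hP.
    have en0 : 0 <= eta * n%:R by rewrite mulr_ge0 // ltW.
    have h4 : p * (eta * n%:R) ^+ 2 / 4 <= edge_count G Y1 Y2.
      by apply: le_trans eG; have := ler_wpM2l p0 (ler_pM en0 en0 Y1n Y2n); lra.
    rewrite expRN.
    exact: (chebyshev_ratio p0 _ eta0 C0 P0 (expR_gt0 _) np2 hM h4 hP dG).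
  rewrite mul1r ler_wpM2l ?exprn_ge0 // ler_expR lerN2 /b.
  have := ler_wpM2l (_ : 0 <= 5 / eta) Y3n; rewrite divr_ge0 ?(ltW eta0) // => /(_ isT).
  rewrite mulrA divfK ?gt_eqF //; lra.
rewrite !sum_sets_cst.
have e2 := expR_two n; have e0 : 0 <= (2 : R) ^+ n by rewrite exprn_ge0.
have -> : expR (- n%:R) =
   expR n%:R * (expR n%:R * (expR n%:R * (expR n%:R * expR (- (5 * n%:R))))) :> R.
  rewrite -!expRD; congr expR; ring.
by do 3 (rewrite ler_pM ?mulr_ge0 ?expR_ge0 //); rewrite ler_wpM2r ?expR_ge0.
Qed.

End Pseudorandom.

(** * Coloured configurations *)

Section ColouredCounts.
Variables (R : realType) (n : nat).
Implicit Types (p : R) (G D : graph n) (X A Z K : {set 'I_n}).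
Local Notation V := 'I_n.

(* [D] is the set of edges of one colour; [wconfs] requires the edge [xy] of the
   triangle to have the other colour. *)
Definition wconfs G D X a b : {set V * V * V} :=
  [set u in confs G a b | [&& u.1.1 \in X, u.1.2 \in X, u.2 \in X,
     ~~ adj D u.1.1 u.1.2, adj D u.1.1 a & adj D u.1.2 b]].

Definition weight G D X a b : R := #|wconfs G D X a b|%:R.

Definition spread G D X A (theta g eta : R) : bool :=
  [forall K : {set V}, [&& K \subset A & eta <= #|K|%:R] ==>
     (g * #|A|%:R < \sum_(v in K) \sum_(a in K) Num.min (weight G D X v a) (theta / 2))].

Definition light G D X A (theta s : R) (N : {set V}) : bool :=
  [exists S : {set V}, [&& S \subset N :&: A, s <= #|S|%:R &
     \sum_(v in S) \sum_(a in S) weight G D X v a <= theta * s / 4]].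

(* The pair [i] consists of a colour class on the edges outside [cross Z A0] and of a
   set [A]; the edges of [cross Z A0] are ignored in [weight] and [spread] so that they
   stay random when [i] is chosen. *)
Definition many_light X Z A0 (theta g eta s gam m : R) G : bool :=
  [exists i : graph n * {set V},
    [&& i.1 \subset G :\: cross Z A0, i.2 \subset A0, (#|G :\: cross Z A0|%:R <= m) &
        spread (G :\: cross Z A0) i.1 X i.2 theta g eta] &&
    (gam <= #|[set z in Z | light (G :\: cross Z A0) i.1 X i.2 theta s
                               (nbr G z :&: A0)]|%:R)].

(** A graph with at most [m] edges has at most [expR m] subgraphs to serve as colour class, and
    there are at most [2 ^+ n] sets for the second component. For each choice [light_neighbourhood]
    bounds a single row and [cond_rows_tail] the number of bad rows. *)
Lemma not_many_light p X Z A0 (theta g eta s gam m k l b : R) :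
  0 <= p <= 1 -> [disjoint Z & A0] -> 0 < theta -> 0 < g -> 0 < eta -> 0 <= l -> 0 <= b ->
  theta * n%:R <= k * g ->
  l * (2 * k - s / 2) + n%:R * p * expR (- l) + expR l * p * eta <= - b ->
  Ex p (fun G => (many_light X Z A0 theta g eta s gam m G)%:R) <=
  expR m * 2 ^+ n * (2 ^+ n * expR (- (b * gam))).
Proof.
move=> p01 dZA t0 g0 eta0 l0 b0 tk hb.
pose J G0 (i : graph n * {set V}) := [&& i.1 \subset G0, i.2 \subset A0,
   (#|G0|%:R <= m) & spread G0 i.1 X i.2 theta g eta].
pose B G0 (i : graph n * {set V}) (z : V) (N : {set V}) := light G0 i.1 X i.2 theta s N.
apply: (cond_rows_tail (J := J) (B := B) (K := expR m * 2 ^+ n) gam p01 dZA b0).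
  move=> G0; case: (boolP (#|G0|%:R <= m)) => [Gm|/negbTE Gm]; last first.
    rewrite (_ : #|_| = 0%N) ?mulr_ge0 ?exprn_ge0 ?expR_ge0 //.
    by apply: eq_card0 => i; rewrite unfold_in /J Gm !andbF.
  apply: (@le_trans _ _ (#|setX (powerset G0) [set: {set V}]|%:R : R)).
    rewrite ler_nat; apply: subset_leq_card; apply/subsetP => -[D A].
    by rewrite unfold_in !inE andbT => /and4P[].
  rewrite cardsX card_powerset -powersetT card_powerset cardsT card_ord natrM !natrX.
  rewrite ler_wpM2r ?exprn_ge0 //; apply: le_trans (expR_two R _) _.
  by rewrite ler_expR.
move=> G i z /and4P[_ iA _ LD] zZ.
apply: (@le_trans _ _ (Ex p (fun G' => [exists S : {set V},
   [&& S \subset nbr G' z :&: i.2, s <= #|S|%:R &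
     \sum_(v in S) \sum_(a in S) weight G i.1 X v a <= theta * s / 4]]%:R))).
  apply: le_Ex => // H; rewrite /B /light.
  rewrite (_ : _ :&: A0 :&: i.2 = nbr H z :&: i.2) //.
  by rewrite -setIA; congr (_ :&: _); apply/setIidPr.
have zA : z \notin i.2.
  by apply: contraTN zZ => /(subsetP iA) zA0; rewrite (disjointFl dZA zA0).
apply: le_trans (light_neighbourhood (k := k) s p01 _ t0 g0 eta0 l0 zA _ _) _ => //.
- move=> K KA Ke; move/forallP: LD => /(_ K); rewrite KA Ke; exact.
- apply: le_trans tk; rewrite ler_wpM2l ?(ltW t0) // ler_nat.
  by rewrite (leq_trans (max_card _)) // card_ord.
- by rewrite ler_expR.
Qed.

End ColouredCounts.

(** * Spread weights from rich triangles *)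

Section LocalDensity.
Variables (R : realType) (n : nat).
Implicit Types (p : R) (G D : graph n) (X A Z K Y : {set 'I_n}).
Local Notation V := 'I_n.

Lemma sqr_sum_le Y (f : V -> R) :
  (\sum_(x in Y) f x) ^+ 2 <= #|Y|%:R * \sum_(x in Y) f x ^+ 2.
Proof.
have h : \sum_(x in Y) \sum_(y in Y) (f x * f y) <=
    \sum_(x in Y) \sum_(y in Y) ((f x ^+ 2 + f y ^+ 2) / 2).
  by apply: ler_sum => x _; apply: ler_sum => y _; have := sqr_ge0 (f x - f y); lra.
rewrite expr2 big_distrlr /=; apply: le_trans h _.
have -> : \sum_(x in Y) \sum_(y in Y) ((f x ^+ 2 + f y ^+ 2) / 2) =
  \sum_(x in Y) (#|Y|%:R * (f x ^+ 2 / 2)) + \sum_(x in Y) (\sum_(y in Y) f y ^+ 2) / 2.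
  rewrite -big_split; apply: eq_bigr => x _ /=.
  rewrite mulr_suml mulr_natl -sumr_const -big_split; apply: eq_bigr => y _ /=; lra.
rewrite sumr_const -mulr_sumr -mulr_suml -[X in _ + X]mulr_natl; lra.
Qed.

(** Values below [t] add up to at most [n * t], so at least [m / 2] comes from the large values, and
    the Cauchy-Schwarz inequality bounds their number from below. *)
Lemma many_large_values X (f : V -> R) (m t S : R) : (forall x, 0 <= f x) -> 0 <= m ->
  n%:R * t <= m / 2 -> 0 <= t -> m <= \sum_(x in X) f x -> \sum_x f x ^+ 2 <= S ->
  (m / 2) ^+ 2 <= #|[set x in X | (t <= f x)%R]|%:R * S.
Proof.
move=> f0 m0 nt t0 hm hS; set Y := [set x in X | _].
apply: (@le_trans _ _ ((\sum_(x in Y) f x) ^+ 2)).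
  apply: lerXn2r; rewrite ?nnegrE ?divr_ge0 ?sumr_ge0 //.
  have : \sum_(x in X) f x <= \sum_(x in Y) f x + n%:R * t.
    rewrite (bigID (mem Y)) /=; apply: lerD.
      rewrite [X in X <= _](eq_bigl (mem Y)) // => x.
      by rewrite !inE; case: (x \in X).
    rewrite -[n in n%:R](card_ord n) mulr_natl -sumr_const big_mkcond.
    apply: ler_sum => x _; case: ifP => //; rewrite !inE.
    by case: (x \in X) => //=; rewrite -ltNge => /ltW.
  lra.
apply: le_trans (sqr_sum_le _ _) _; apply: ler_wpM2l => //.
apply: le_trans hS; rewrite big_mkcond; apply: ler_sum => x _.
by case: ifP => // _; apply: sqr_ge0.
Qed.

Lemma exists_subset_card (T : finType) (Y : {set T}) k : (k <= #|Y|)%N ->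
  exists2 Y1 : {set T}, Y1 \subset Y & #|Y1| = k.
Proof.
move=> kY; have : (0 < #|[set A : {set T} | A \subset Y & #|A| == k]|)%N.
  by rewrite cards_draws bin_gt0.
by case/card_gt0P => A; rewrite inE => /andP[AY /eqP]; exists A.
Qed.

Lemma three_parts (T : finType) (Y : {set T}) k : (3 * k <= #|Y|)%N ->
  exists Y1 Y2 Y3 : {set T},
    [/\ [disjoint Y1 & Y2], [disjoint Y1 & Y3] & [disjoint Y2 & Y3]] /\
    [/\ Y1 \subset Y, Y2 \subset Y & Y3 \subset Y] /\
    [/\ #|Y1| = k, #|Y2| = k & #|Y3| = k].
Proof.
move=> kY; have [|Y1 s1 c1] := @exists_subset_card T Y k; first by lia.
have D1 : #|Y :\: Y1| = (#|Y| - k)%N by rewrite cardsD (setIidPr s1) c1.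
have [|Y2 s2 c2] := @exists_subset_card T (Y :\: Y1) k; first by rewrite D1; lia.
have D2 : #|(Y :\: Y1) :\: Y2| = (#|Y| - k - k)%N by rewrite cardsD (setIidPr s2) D1 c2.
have [|Y3 s3 c3] := @exists_subset_card T ((Y :\: Y1) :\: Y2) k; first by rewrite D2; lia.
move: s2 s3; rewrite !subsetD => /andP[s2 d12] /andP[/andP[s3 d13] d23].
by exists Y1, Y2, Y3; rewrite (disjoint_sym Y1 Y2) (disjoint_sym Y1 Y3) (disjoint_sym Y2 Y3).
Qed.

Lemma sum_nbr_exchange D X K :
  \sum_(x in X) #|nbr D x :&: K|%:R = \sum_(a in K) #|nbr D a :&: X|%:R :> R.
Proof.
have E x (S : {set V}) : #|nbr D x :&: S|%:R = \sum_(a in S) ((adj D x a)%:R : R).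
  rewrite -sum1_card natr_sum big_mkcond [RHS]big_mkcond; apply: eq_bigr => a _.
  by rewrite !inE; case: (adj D x a); case: (a \in S).
under eq_bigr do rewrite E; rewrite exchange_big /=.
by apply: eq_bigr => a _; rewrite E; apply: eq_bigr => x _; rewrite adjC.
Qed.

(** A triangle is not contained in the triangle-free [D]. An injection of triples moves its edge
    outside [D] to the first two coordinates; three such maps cover the three edges. *)
Lemma card_triangles_le G D Y Y1 Y2 Y3 :
  (forall x y t, adj D x y -> adj D x t -> adj D y t -> False) ->
  Y1 \subset Y -> Y2 \subset Y -> Y3 \subset Y ->
  (#|triangles G Y1 Y2 Y3| <=
   3 * #|[set u in triangles G Y Y Y | ~~ adj D u.1.1 u.1.2]|)%N.
Proof.
move=> tf /subsetP s1 /subsetP s2 /subsetP s3; set U := [set u in _ | _].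
pose f (u : V * V * V) := (u.1.1, u.2, u.1.2).
pose g (u : V * V * V) := (u.1.2, u.2, u.1.1).
have fI : injective f by move=> [[? ?] ?] [[? ?] ?] [-> -> ->].
have gI : injective g by move=> [[? ?] ?] [[? ?] ?] [-> -> ->].
rewrite !mulSn mul0n addn0 -{2}(card_preimset U fI) -{2}(card_preimset U gI).
apply: leq_trans (_ : #|U :|: (f @^-1: U :|: g @^-1: U)| <= _)%N; last first.
  apply: leq_trans (leq_card_setU _ _) _; rewrite leq_add2l; exact: leq_card_setU.
apply/subset_leq_card/subsetP => -[[x y] t]; rewrite !inE /=.
move=> /and5P[/s1 -> /s2 -> /s3 -> a1 /andP[a2 a3]].
rewrite a1 a2 a3 (adjC G t) a3 (adjC G y x) a1 (adjC G t) a2 /=.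
case: (boolP (adj D x y)) => // d1; case: (boolP (adj D x t)) => // d2.
by case: (boolP (adj D y t)) => // d3; case: (tf _ _ _ d1 d2 d3).
Qed.

(** A triangle in [Y] with [x y] outside [D] extends by any [D]-neighbours [a] of [x] and [b] of [y]
    in [K] that are distinct; the last condition turns [t * t] into [t * (t - 1)]. *)
Lemma weight_sum_ge G D X K Y (t : R) : D \subset G -> [disjoint X & K] -> Y \subset X ->
  1 <= t -> (forall x, x \in Y -> t <= #|nbr D x :&: K|%:R) ->
  #|[set u in triangles G Y Y Y | ~~ adj D u.1.1 u.1.2]|%:R * (t * (t - 1)) <=
  \sum_(a in K) \sum_(b in K) weight R G D X a b.
Proof.
move=> DG dXK YX t1 ht; set U := [set u in _ | _].
have -> : \sum_(a in K) \sum_(b in K) weight R G D X a b =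
    \sum_u \sum_(a in K) \sum_(b in K) ((u \in wconfs G D X a b)%:R : R).
  rewrite [RHS]exchange_big /=; apply: eq_bigr => a _; rewrite [RHS]exchange_big /=.
  apply: eq_bigr => b _; rewrite /weight -sum1_card natr_sum big_mkcond.
  by apply: eq_bigr => u _; case: (u \in _).
rewrite mulr_natl -sumr_const big_mkcond; apply: ler_sum => -[[x y] z] _.
case: ifP => [|_]; last by apply: sumr_ge0 => *; apply: sumr_ge0.
rewrite !inE /= => /andP[/and5P[xY yY zY a1 /andP[a2 a3]] nD].
pose Sx := nbr D x :&: K; pose Sy := nbr D y :&: K.
have w1 a b : a \in Sx -> b \in Sy -> b != a -> (x, y, z) \in wconfs G D X a b.
  move=> /setIP[+ aK] /setIP[+ bK] ba; rewrite (in_set (adj D x)) (in_set (adj D y)) => xa yb.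
  have [[xX yX] zX] := (subsetP YX _ xY, subsetP YX _ yY, subsetP YX _ zY).
  have ne u v : u \in X -> v \in K -> u != v.
    by move=> uX vK; apply: contraTneq uX => ->; rewrite (disjointFl dXK vK).
  rewrite in_set [_ \in confs _ _ _]in_set /conf /= a1 a2 a3 (adjS DG xa) (adjS DG yb) xX yX zX nD xa yb /= !andbT.
  rewrite !inE !negb_or (adj_neq a1) (adj_neq a2) (adj_neq a3) /=.
  by rewrite [a == b]eq_sym ba !ne.
have cx : t <= #|Sx|%:R by exact: ht.
have cy : t <= #|Sy|%:R by exact: ht.
apply: (@le_trans _ _ (\sum_(a in Sx) (#|Sy|%:R - 1))).
  rewrite sumr_const -[X in _ <= X]mulr_natl; apply: ler_pM => //; lra.
rewrite big_mkcond [X in _ <= X]big_mkcond; apply: ler_sum => a _.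
case: ifP => [aS|_]; last by case: ifP => // _; apply: sumr_ge0.
have -> : a \in K by move: aS; rewrite inE => /andP[].
apply: (@le_trans _ _ (\sum_(b in Sy :\ a) 1)).
  rewrite sumr_const lerBlDr natr1 ler_nat.
  by rewrite (cardsD1 a Sy); case: (a \in Sy).
rewrite big_mkcond [X in _ <= X]big_mkcond; apply: ler_sum => b _.
case: ifP => [/setD1P[ba bS]|_]; last by case: ifP.
by rewrite w1 //; move: bS; rewrite inE => /andP[_ ->].
Qed.

(** The loss caused by a cap is at most the square divided by the cap, so a second moment bound
    controls the total loss. *)
Lemma min_ge_sub (w h : R) : 0 <= w -> 0 < h -> w - w ^+ 2 / h <= Num.min w h.
Proof.
move=> w0 h0; rewrite le_min; apply/andP; split.
  by rewrite gerBl divr_ge0 ?sqr_ge0 // ltW.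
rewrite -(ler_pM2r h0) mulrBl divfK ?gt_eqF //.
have := sqr_ge0 (w - h); have := sqr_ge0 w; have := sqr_ge0 h; nra.
Qed.

Lemma weight_le_confs G D X a b : weight R G D X a b <= #|confs G a b|%:R.
Proof.
by rewrite ler_nat; apply/subset_leq_card/subsetP => u; rewrite inE => /andP[].
Qed.

End LocalDensity.

Lemma leq_mul_div3 m : (8 <= m -> m <= 4 * (m %/ 3))%N.
Proof. lia. Qed.

Section Spread.
Variables (R : realType) (n : nat).
Implicit Types (p : R) (G D : graph n) (X A Z K Y : {set 'I_n}).
Local Notation V := 'I_n.
Local Notation N := (n%:R : R).

(** Every edge of a configuration lies inside [X] or between [X] and [A0], so none is in
    [cross Z A0]: the weights are determined before those pairs are revealed. *)
Lemma weight_cross G D X Z A0 a b : [disjoint X & Z] -> [disjoint A0 & Z] ->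
  [disjoint X & A0] -> a \in A0 -> b \in A0 ->
  weight R (G :\: cross Z A0) (D :\: cross Z A0) X a b = weight R G D X a b.
Proof.
move=> dXZ dAZ dXA aA bA; congr (_%:R); apply: eq_card => -[[x y] t].
have adjX H u v : u \in X -> (v \in X) || (v \in A0) -> adj (H :\: cross Z A0) u v = adj H u v.
  move=> uX vXA; apply: eq_adj => e /eqP eE; rewrite in_setD (in_cross _ _ eE).
  rewrite (disjointFr dXZ uX) /=.
  by case/orP: vXA => [vX|vA]; rewrite ?(disjointFr dXZ vX) ?(disjointFr dAZ vA).
rewrite !inE /= /conf.
case: (boolP (x \in X)) => xX; last by rewrite !andbF.
case: (boolP (y \in X)) => yX; last by rewrite !andbF.
case: (boolP (t \in X)) => tX; last by rewrite !andbF.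
by rewrite !adjX ?yX ?tX ?aA ?bA ?orbT.
Qed.

(** The degrees from [X] into [K] have a large sum, so by [many_large_values] the set [Y] of
    vertices of degree at least [c1 * (N * p)] into [K] is of linear size. Triangles inside [Y],
    each with an edge outside [D], give total weight [kap * (N ^+ 5 * p ^+ 5)]; capping loses at
    most a quarter of it, which leaves more than the required half. *)
Lemma spread_of_rich p G D X A (eta c0 C theta : R) :
  let eta1 := eta ^+ 2 * c0 ^+ 2 / (16 * C) in
  let c1 := eta * c0 / 2 in
  let kap := eta1 ^+ 3 * c1 ^+ 2 / 96 in
  0 < p -> D \subset G -> [disjoint X & A] ->
  (forall x y t, adj D x y -> adj D x t -> adj D y t -> False) ->
  (forall a, a \in A -> c0 * (N * p) <= #|nbr D a :&: X|%:R) ->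
  \sum_x #|nbr G x|%:R ^+ 2 <= C * (N ^+ 3 * p ^+ 2) ->
  \sum_a \sum_b #|confs G a b|%:R ^+ 2 <= C * (N ^+ 5 * p ^+ 5 * (N ^+ 3 * p ^+ 5 + 1)) ->
  rich_triangles p eta1 G ->
  0 < C -> 0 < eta -> 0 < c0 -> 0 < theta ->
  2 <= c1 * (N * p) -> 2 <= eta1 * N -> 8 * C * (N ^+ 3 * p ^+ 5 + 1) <= kap * theta ->
  spread G D X A theta (kap * (N ^+ 4 * p ^+ 5) / 2) (eta * N).
Proof.
move=> eta1 c1 kap p0 DG dXA tf hA hG2 hG3 hG5 C0 eta0 c00 th0 hd hn hth.
have eta10 : 0 < eta1 by rewrite /eta1 divr_gt0 ?mulr_gt0 ?exprn_gt0.
have c10 : 0 < c1 by rewrite /c1 divr_gt0 ?mulr_gt0.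
have kap0 : 0 < kap by apply: divr_gt0 => //; apply: mulr_gt0; exact: exprn_gt0.
have N0 : 0 < N.
  by rewrite -(pmulr_rgt0 _ eta10); apply: lt_le_trans hn.
have d0 : 0 < N * p by rewrite mulr_gt0.
apply/forallP => K; apply/implyP => /andP[KA Kn].
pose dK x : R := #|nbr D x :&: K|%:R.
pose Y := [set x in X | (c1 * (N * p) <= dK x)%R].
have S2 : \sum_x dK x ^+ 2 <= C * (N ^+ 3 * p ^+ 2).
  apply: le_trans hG2; apply: ler_sum => x _; apply: lerXn2r; rewrite ?nnegrE //.
  rewrite ler_nat subset_leq_card //; apply: subset_trans (subsetIl _ _) _.
  by apply/subsetP => y; rewrite !inE; apply: adjS.
have S1 : eta * N * (c0 * (N * p)) <= \sum_(x in X) dK x.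
  rewrite sum_nbr_exchange; apply: (@le_trans _ _ (\sum_(a in K) c0 * (N * p))).
    rewrite sumr_const -[X in _ <= X]mulr_natl ler_wpM2r //.
    by rewrite mulr_ge0 // ltW.
  by apply: ler_sum => a aK; apply: hA; apply: (subsetP KA).
have Ybig : 4 * eta1 * N <= #|Y|%:R.
  have := @many_large_values R n X dK _ (c1 * (N * p)) _ _ _ _ _ S1 S2.
  rewrite -/Y => /(_ _ _ _ _)hY.
  have {hY} : (eta * N * (c0 * (N * p)) / 2) ^+ 2 <= #|Y|%:R * (C * (N ^+ 3 * p ^+ 2)).
    apply: hY; first by move=> x; rewrite /dK.
    - by rewrite !mulr_ge0 // ltW.
    - by rewrite /c1; lra.
    - by rewrite mulr_ge0 // ltW.
  have T0 : 0 < N ^+ 3 * p ^+ 2 by rewrite mulr_gt0 ?exprn_gt0.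
  have -> : (eta * N * (c0 * (N * p)) / 2) ^+ 2 = 4 * eta1 * N * C * (N ^+ 3 * p ^+ 2).
    by rewrite /eta1; field; rewrite gt_eqF.
  by rewrite [X in _ <= X]mulrA (ler_pM2r T0) (ler_pM2r C0).
have [Y1 [Y2 [Y3 [[d12 d13 d23] [[s1 s2 s3] [k1 k2 k3]]]]]] :
    exists Y1 Y2 Y3 : {set V}, [/\ [disjoint Y1 & Y2], [disjoint Y1 & Y3] & [disjoint Y2 & Y3]] /\
    [/\ Y1 \subset Y, Y2 \subset Y & Y3 \subset Y] /\
    [/\ #|Y1| = (#|Y| %/ 3)%N, #|Y2| = (#|Y| %/ 3)%N & #|Y3| = (#|Y| %/ 3)%N].
  by apply: three_parts; rewrite mulnC leq_trunc_div.
(* The 4 in [4 * eta1 * N] leaves room for rounding: for [#|Y|] at least 8 the floor of a third is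
   at least a quarter. *)
have kn : eta1 * N <= (#|Y| %/ 3)%:R.
  have Y8 : (8 <= #|Y|)%N by rewrite -(ler_nat R); lra.
  have : (#|Y| <= 4 * (#|Y| %/ 3))%N by exact: leq_mul_div3.
  rewrite -(ler_nat R) natrM; lra.
have tri : eta1 ^+ 3 * N ^+ 3 * p ^+ 3 / 16 <= #|triangles G Y1 Y2 Y3|%:R.
  move: hG5 => /forallP/(_ Y1)/forallP/(_ Y2)/forallP/(_ Y3).
  by rewrite d12 d13 d23 k1 k2 k3 kn.
have := card_triangles_le G tf s1 s2 s3.
rewrite -(ler_nat R) natrM; set U := #|[set u in _ | _]|%:R => hU.
have sumw : 2 * kap / 2 * (N ^+ 5 * p ^+ 5) <= \sum_(a in K) \sum_(b in K) weight R G D X a b.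
  apply: le_trans (weight_sum_ge (t := c1 * (N * p)) DG _ _ _ _).
  - rewrite -/U; have : eta1 ^+ 3 * N ^+ 3 * p ^+ 3 / 48 <= U by lra.
    have h : (c1 * (N * p)) ^+ 2 / 2 <= c1 * (N * p) * (c1 * (N * p) - 1) by nra.
    move=> hU'; apply: le_trans (ler_pM _ _ hU' h); last by rewrite divr_ge0 ?sqr_ge0.
      rewrite /kap; lra.
    by apply: divr_ge0 => //; apply: mulr_ge0; first apply: mulr_ge0; apply: exprn_ge0; exact: ltW.
  - exact: disjointWr KA dXA.
  - by apply/subsetP => x; rewrite inE => /andP[].
  - by lra.
  - by move=> x; rewrite inE => /andP[].
have sumw2 : \sum_(a in K) \sum_(b in K) weight R G D X a b ^+ 2 <=
    C * (N ^+ 5 * p ^+ 5 * (N ^+ 3 * p ^+ 5 + 1)).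
  apply: le_trans hG3; rewrite big_mkcond; apply: ler_sum => a _.
  case: ifP => [_|_]; last by apply: sumr_ge0 => *; apply: sqr_ge0.
  rewrite big_mkcond; apply: ler_sum => b _; case: ifP => _; last exact: sqr_ge0.
  by apply: lerXn2r; rewrite ?nnegrE ?ler0n // weight_le_confs.
have summin : \sum_(a in K) \sum_(b in K) weight R G D X a b -
     (\sum_(a in K) \sum_(b in K) weight R G D X a b ^+ 2) / (theta / 2) <=
  \sum_(a in K) \sum_(b in K) Num.min (weight R G D X a b) (theta / 2).
  rewrite mulr_suml -sumrB; apply: ler_sum => a _.
  rewrite mulr_suml -sumrB; apply: ler_sum => b _.
  by apply: min_ge_sub; rewrite ?ler0n // divr_gt0.
apply: lt_le_trans summin.
have cap : (\sum_(a in K) \sum_(b in K) weight R G D X a b ^+ 2) / (theta / 2) <=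
    kap / 4 * (N ^+ 5 * p ^+ 5).
  rewrite ler_pdivrMr ?divr_gt0 //; apply: le_trans sumw2 _.
  have T0 : 0 <= N ^+ 5 * p ^+ 5 by rewrite mulr_ge0 ?exprn_ge0 // ltW.
  have := ler_wpM2l T0 hth; lra.
have AN : kap * (N ^+ 4 * p ^+ 5) / 2 * #|A|%:R <= kap / 2 * (N ^+ 5 * p ^+ 5).
  rewrite [X in _ <= X](_ : _ = kap * (N ^+ 4 * p ^+ 5) / 2 * N); last by ring.
  apply: ler_wpM2l; last by rewrite ler_nat (leq_trans (max_card _)) // card_ord.
  apply: divr_ge0 => //; apply: mulr_ge0; first exact: ltW.
  by apply: mulr_ge0; apply: exprn_ge0; exact: ltW.
have : 0 < kap * (N ^+ 5 * p ^+ 5) by apply: mulr_gt0 => //; apply: mulr_gt0; exact: exprn_gt0.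
lra.
Qed.

End Spread.

(** * Colour classes and majority colours *)

Section Colourings.
Variables (R : realType) (n : nat).
Implicit Types (p : R) (G D : graph n) (X A Z K Y : {set 'I_n}) (c : colouring n).
Local Notation V := 'I_n.
Local Notation N := (n%:R : R).

Definition colour_class G c (k : bool) : graph n := [set e in G | c e == k].

Lemma colour_class_sub G c k : colour_class G c k \subset G.
Proof. by apply/subsetP => e; rewrite inE => /andP[]. Qed.

Lemma adj_colour G c k x y : adj G x y -> ~~ adj (colour_class G c k) x y ->
  adj (colour_class G c (~~ k)) x y.
Proof.
move=> /exists_inP[e eG exy] /exists_inP nk; apply/exists_inP; exists e => //.
rewrite inE eG /=; case: (eqVneq (c e) k) => [ck|].
  by case: nk; exists e; rewrite // inE eG ck eqxx.
by clear nk; case: (c e) k => [] [].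
Qed.

Lemma mono_triangleP G c k x y t : adj (colour_class G c k) x y ->
  adj (colour_class G c k) x t -> adj (colour_class G c k) y t ->
  ~~ no_mono_triangle G c.
Proof.
move=> xy xt yt; apply/forallPn; exists [set x; y; t]; rewrite negbK.
have [nxy nxt nyt] := And3 (adj_neq xy) (adj_neq xt) (adj_neq yt).
apply/andP; split.
  by rewrite setUC cardsU1 !inE negb_or [t == x]eq_sym [t == y]eq_sym nxt nyt cards2 nxy.
apply/existsP; exists k; apply/forallP => e; apply/implyP => esub.
have key u v : adj (colour_class G c k) u v -> val e = [set u; v] -> (e \in G) && (c e == k).
  move=> /exists_inP[e']; rewrite inE => /andP[eG ce] /eqP e'E eE.
  by rewrite (_ : e = e') ?eG //; apply: val_inj; rewrite eE.
have /cards2P[u [v [uv eE]]] := valP e.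
move: esub; rewrite /= eE subUset !sub1set !inE => /andP[hu hv].
case/orP: hu => [/orP[]|] /eqP ue; case/orP: hv => [/orP[]|] /eqP ve; subst u v;
  rewrite ?eqxx // in uv *.
- exact: key xy eE.
- exact: key xt eE.
- by apply: key xy _; rewrite eE setUC.
- exact: key yt eE.
- by apply: key xt _; rewrite eE setUC.
- by apply: key yt _; rewrite eE setUC.
Qed.

(** An explicit partition of the vertices: residues 0, 1, 2 are the classes [X_i] and residue 3 is
    [A_0]. *)
Definition residue i : {set V} := [set x : V | x %% 4 == i]%N.

Lemma residue_disjoint i j : i != j -> [disjoint residue i & residue j].
Proof.
move=> ij; rewrite disjoints_subset; apply/subsetP => x; rewrite !inE => /eqP->.
by [].
Qed.

Lemma card_residue i : (20 <= n)%N -> (i < 4)%N -> N / 5 <= #|residue i|%:R.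
Proof.
move=> n20 i4; have lt_n (j : 'I_(n %/ 4)) : (4 * j + i < n)%N.
  by case: j => j /=; move: i4 n20; clear; lia.
pose f (j : 'I_(n %/ 4)) : V := Ordinal (lt_n j).
have fI : injective f.
  by move=> j j' /(congr1 val) /= /addIn /eqP; rewrite eqn_pmul2l // => /eqP /val_inj.
have : (n %/ 4 <= #|residue i|)%N.
  rewrite -[X in (X <= _)%N]card_ord -(card_codom fI); apply/subset_leq_card/subsetP => x.
  by case/codomP => j ->; rewrite inE /= mulnC modnMDl modn_small.
have : (n <= 5 * (n %/ 4))%N by move: n20; clear; lia.
rewrite -(ler_nat R) natrM -(ler_nat R (n %/ 4)); lra.
Qed.

(** By density fewer than [N / 40] vertices of [residue 3] have low degree into a given other class,
    so at least [N / 10] are good. Two of the three majority colours of a good vertex agree, so the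
    six sets [S i j k] cover [good] and one of them is large. *)
Lemma common_majority p G c : 0 < p -> (20 <= n)%N -> dense_pairs p (1 / 40) G ->
  exists i j k A, [/\ [&& (i < 3)%N, (j < 3)%N & i != j], A \subset residue 3,
    N / 180 <= #|A|%:R,
    forall a, a \in A -> 1 / 50 * (N * p) <= #|nbr (colour_class G c k) a :&: residue i|%:R &
    forall a, a \in A -> 1 / 50 * (N * p) <= #|nbr (colour_class G c k) a :&: residue j|%:R].
Proof.
move=> p0 n20 dG; have N0 : 0 < N by rewrite ltr0n; exact: leq_trans n20.
pose D k := colour_class G c k.
pose low i := [set a in residue 3 | (#|nbr G a :&: residue i|%:R < p * #|residue i|%:R / 5)%R].
have ri i : (i < 3)%N -> N / 5 <= #|residue i|%:R.
  by move=> i3; apply: card_residue => //; apply: ltn_trans i3 _.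
have low_small i : (i < 3)%N -> #|low i|%:R < N / 40.
  move=> i3; rewrite ltNge; apply/negP => lown; have Ri := ri i i3.
  move: dG => /forallP/(_ (residue i))/forallP/(_ (low i))/implyP.
  have -> : [disjoint residue i & low i].
    apply: disjointWr (residue_disjoint (_ : i != 3)).
      by apply/subsetP => a; rewrite inE => /andP[].
    by rewrite neq_ltn i3.
  have -> : 1 / 40 * N <= #|low i|%:R by lra.
  have -> : 1 / 40 * N <= #|residue i|%:R by lra.
  move=> /(_ isT); apply/negP; rewrite -ltNge.
  apply: (@le_lt_trans _ _ (\sum_(v in low i) p * #|residue i|%:R / 5)).
    by apply: ler_sum => v; rewrite inE => /andP[_ /ltW].
  rewrite sumr_const -[X in X < _]mulr_natl.
  have : 0 < #|low i|%:R * (p * #|residue i|%:R) by rewrite !mulr_gt0 //; lra.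
  lra.
pose good := residue 3 :\: (low 0 :|: (low 1 :|: low 2)).
have good_big : N / 10 <= #|good|%:R.
  have : (#|residue 3| <= #|good| + (#|low 0| + (#|low 1| + #|low 2|)))%N.
    rewrite -[X in (X <= _)%N](cardsID (low 0 :|: (low 1 :|: low 2))) addnC leq_add2l.
    apply: leq_trans (subset_leq_card (subsetIr _ _)) _.
    apply: leq_trans (leq_card_setU _ _) _; rewrite leq_add2l; exact: leq_card_setU.
  rewrite -(ler_nat R) !natrD; have := card_residue n20 (isT : 3 < 4)%N.
  have := low_small 0%N isT; have := low_small 1%N isT; have := low_small 2%N isT; lra.
pose maj i a := (#|nbr (D false) a :&: residue i| <= #|nbr (D true) a :&: residue i|)%N.
(* The majority colour has at least half of a degree that is at least [p * (N / 5) / 5]; hence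
   [1 / 50]. *)
have majP i a : (i < 3)%N -> a \in good ->
    1 / 50 * (N * p) <= #|nbr (D (maj i a)) a :&: residue i|%:R.
  move=> i3; rewrite !inE !negb_or => /andP[al a3].
  have : p * #|residue i|%:R / 5 <= #|nbr G a :&: residue i|%:R.
    move: al; rewrite a3 /= -!leNgt => /and3P[l0 l1 l2].
    by case: i i3 => [|[|[|i]]].
  have : (#|nbr G a :&: residue i| <= #|nbr (D (maj i a)) a :&: residue i| +
                                      #|nbr (D (maj i a)) a :&: residue i|)%N.
    have GD : (#|nbr G a :&: residue i| <= #|nbr (D true) a :&: residue i| +
                                          #|nbr (D false) a :&: residue i|)%N.
      apply: leq_trans (leq_card_setU _ _); apply/subset_leq_card/subsetP => x.
      rewrite !inE => /andP[ax ->]; rewrite !andbT.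
      by case: (boolP (adj (D true) a x)) => //= /(adj_colour ax).
    apply: (leq_trans GD); rewrite /maj.
    case: (leqP #|nbr (D false) a :&: _| #|nbr (D true) a :&: _|) => h; first by rewrite leq_add2l.
    by rewrite leq_add2r ltnW.
  rewrite -(ler_nat R) natrD; have := ler_wpM2l (ltW p0) (ri i i3); lra.
pose S i j k := [set a in good | (maj i a == k) && (maj j a == k)].
have SP i j k : (i < 3)%N -> (j < 3)%N -> i != j -> N / 180 <= #|S i j k|%:R ->
    exists i j k A, [/\ [&& (i < 3)%N, (j < 3)%N & i != j], A \subset residue 3,
    N / 180 <= #|A|%:R,
    forall a, a \in A -> 1 / 50 * (N * p) <= #|nbr (colour_class G c k) a :&: residue i|%:R &
    forall a, a \in A -> 1 / 50 * (N * p) <= #|nbr (colour_class G c k) a :&: residue j|%:R].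
  move=> i3 j3 ij hS; exists i, j, k, (S i j k); split=> //.
  - by rewrite i3 j3.
  - by apply/subsetP => a; rewrite !inE => /andP[/andP[]].
  - by move=> a; rewrite inE => /and3P[ga /eqP <- _]; apply: majP.
  - by move=> a; rewrite inE => /and3P[ga _ /eqP <-]; apply: majP.
have [/SP|h1] := leP (N / 180) #|S 0 1 true|%:R; first by apply.
have [/SP|h2] := leP (N / 180) #|S 0 1 false|%:R; first by apply.
have [/SP|h3] := leP (N / 180) #|S 0 2 true|%:R; first by apply.
have [/SP|h4] := leP (N / 180) #|S 0 2 false|%:R; first by apply.
have [/SP|h5] := leP (N / 180) #|S 1 2 true|%:R; first by apply.
have [/SP|h6] := leP (N / 180) #|S 1 2 false|%:R; first by apply.
have : (#|good| <= (#|S 0 1 true| + #|S 0 1 false|) + ((#|S 0 2 true| + #|S 0 2 false|) +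
   (#|S 1 2 true| + #|S 1 2 false|)))%N.
  apply: (@leq_trans #|(S 0 1 true :|: S 0 1 false) :|: ((S 0 2 true :|: S 0 2 false) :|:
    (S 1 2 true :|: S 1 2 false))|).
    apply/subset_leq_card/subsetP => a ga; rewrite !in_setU.
    have inS i j k : (a \in S i j k) = (maj i a == k) && (maj j a == k) by rewrite in_set ga.
    rewrite !inS.
    by case: (maj 0 a); case: (maj 1 a); case: (maj 2 a).
  apply: leq_trans (leq_card_setU _ _) _; apply: leq_add; first exact: leq_card_setU.
  by apply: leq_trans (leq_card_setU _ _) _; apply: leq_add; exact: leq_card_setU.
rewrite -(ler_nat R) !natrD; lra.
Qed.

End Colourings.

(** * Second moment over the second graph *)

Section BadCopies.
Variables (R : realType) (n : nat).
Implicit Types (p q : R) (G D : graph n) (X A Z K Y : {set 'I_n}) (c : colouring n).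
Local Notation V := 'I_n.
Local Notation N := (n%:R : R).
Local Notation vx := (@Ordinal 6 0 isT).
Local Notation vy := (@Ordinal 6 1 isT).
Local Notation vt := (@Ordinal 6 2 isT).
Local Notation va := (@Ordinal 6 3 isT).
Local Notation vb := (@Ordinal 6 4 isT).
Local Notation vz := (@Ordinal 6 5 isT).

Definition Lp : seq ('I_6 * 'I_6) :=
  [:: (vx, vy); (vx, vt); (vy, vt); (vx, va); (vy, vb); (va, vz); (vb, vz)].

Definition Lq : seq ('I_6 * 'I_6) := [:: (vx, vz); (vy, vz)].

(* The path [x]-[a]-[z] in [D] forces the edge [xz] of [G2] to have the colour of [xy],
   and so does [y]-[b]-[z] with [yz]. *)
Definition bad_copies G D : {set {ffun 'I_6 -> V}} :=
  [set s : {ffun 'I_6 -> V} | [&& injectiveb s, copy Lp s \subset G,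
     ~~ adj D (s vx) (s vy), adj D (s vx) (s va), adj D (s va) (s vz),
     adj D (s vy) (s vb) & adj D (s vb) (s vz)]].

(** Necessary for two copies to share a pair of [Lq], which consists of [z] and one of [x], [y].
    Only pairs sharing one are correlated over the second graph. *)
Definition common_q_edge (O : {set 'I_6}) := (vz \in O) && ((vx \in O) || (vy \in O)).

(** It bounds the correlated pairs for every colouring at once, because it counts all copies in [G]
    and not only the bad ones. *)
Definition pair_count q G : R :=
  \sum_(s' : {ffun 'I_6 -> V} | injectiveb s')
    \sum_(s : {ffun 'I_6 -> V} | injectiveb s && common_q_edge (overlap s s'))
    (copy Lp s \subset G)%:R * (copy Lp s' \subset G)%:R *
     q ^+ #|copy Lq s :|: copy Lq s'|.

(** Of the at least [2 * gam] vertices [z] with large [D]-degree into [A], fewer than [gam] are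
    light. For each of the others the weights on its [D]-neighbours in [A] sum to more than
    [theta * s / 4], and each configuration counted there forms a bad copy with [z]. *)
Lemma many_bad_copies G D X Z A0 A (theta g eta s gam m : R) :
  D \subset G -> [disjoint X & Z] -> [disjoint A0 & Z] -> [disjoint X & A0] ->
  A \subset A0 -> 0 <= theta -> 0 <= s -> #|G|%:R <= m ->
  spread G D X A theta g eta -> ~~ many_light X Z A0 theta g eta s gam m G ->
  2 * gam <= #|[set z in Z | (s <= #|nbr D z :&: A|%:R)%R]|%:R ->
  gam * (theta * s / 4) <= #|bad_copies G D|%:R.
Proof.
move=> DG dXZ dAZ dXA AA0 th0 s0 Gm LD nl hz; set Z1 := [set z in Z | _] in hz.
set C := cross Z A0 in nl.
have wE a b : a \in A -> b \in A ->
    weight R (G :\: C) (D :\: C) X a b = weight R G D X a b.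
  by move=> /(subsetP AA0) aA /(subsetP AA0) bA; apply: weight_cross.
pose Lt := [set z in Z | light (G :\: C) (D :\: C) X A theta s (nbr G z :&: A0)].
have LtS : #|Lt|%:R < gam.
  (* The witness is [D] without [cross Z A0]; by [wE] this leaves the weights unchanged, so [spread]
     carries over. *)
  rewrite ltNge; apply: contra nl => gL; apply/existsP; exists (D :\: C, A) => /=.
  rewrite gL AA0 setSD //= !andbT; apply/andP; split.
    by apply: le_trans Gm; rewrite ler_nat subset_leq_card ?subsetDl.
  apply/forallP => K; apply/implyP => KA; have /andP[KA' _] := KA.
  move: LD => /forallP/(_ K); rewrite KA /=.
  congr (_ < _); apply: eq_bigr => v vK; apply: eq_bigr => a aK.
  by rewrite wE // (subsetP KA').
pose W := Z1 :\: Lt; pose S z := nbr D z :&: A.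
have Wg : gam <= #|W|%:R.
  have : (#|Z1| <= #|Lt| + #|W|)%N.
    by rewrite -[X in (X <= _)%N](cardsID Lt) leq_add2r subset_leq_card ?subsetIr.
  rewrite -(ler_nat R) natrD; lra.
apply: (@le_trans _ _ (\sum_(z in W) \sum_(a in S z) \sum_(b in S z) weight R G D X a b)).
  apply: (@le_trans _ _ (\sum_(z in W) (theta * s / 4))).
    by rewrite sumr_const -[X in _ <= X]mulr_natl ler_wpM2r // divr_ge0 ?mulr_ge0.
  apply: ler_sum => z; rewrite !inE => /andP[nL /andP[zZ sz]].
  rewrite leNgt; apply: contra nL => lt; rewrite zZ /=; apply/existsP; exists (S z).
  rewrite sz andbA; apply/andP; split.
    rewrite andbT subsetI subsetIr andbT subsetI.
    rewrite (subset_trans (subsetIr _ _) AA0) andbT.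
    apply: subset_trans (subsetIl _ _) _; apply/subsetP => w; rewrite !inE.
    exact: adjS.
  apply: le_trans (ltW lt); apply: ler_sum => v; rewrite inE => /andP[_ vA].
  by apply: ler_sum => a; rewrite inE => /andP[_ aA]; rewrite wE.
pose P (i : V * (V * (V * (V * V * V)))) := (i.1 \in W) && ((i.2.1 \in S i.1) &&
   ((i.2.2.1 \in S i.1) && (i.2.2.2 \in wconfs G D X i.2.1 i.2.2.1))).
have -> : \sum_(z in W) \sum_(a in S z) \sum_(b in S z) weight R G D X a b =
    \sum_(i | P i) 1.
  have E z a : \sum_(b in S z) weight R G D X a b =
      \sum_(j : V * (V * V * V) | (j.1 \in S z) && (j.2 \in wconfs G D X a j.1)) 1.
    rewrite -(pair_big_dep (mem (S z)) (fun b u => u \in wconfs G D X a b) (fun _ _ => 1)) /=.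
    by apply: eq_bigr => b _; rewrite /weight -sum1_card natr_sum.
  under eq_bigr do (under eq_bigr do rewrite E; rewrite pair_big_dep /=).
  by rewrite pair_big_dep.
pose h (i : V * (V * (V * (V * V * V)))) := let u := i.2.2.2 in
  ffun_tuple [tuple u.1.1; u.1.2; u.2; i.2.1; i.2.2.1; i.1].
rewrite -sum1_card natr_sum.
apply: (@ler_sum_inj R _ _ h P (mem (bad_copies G D)) (fun=> 1)) => //.
  move=> [z [a [b [[x y] t]]]] [z' [a' [b' [[x' y'] t']]]] _ _.
  by move=> /ffun_tuple_inj/(congr1 val)/= [-> -> -> -> -> ->].
move=> [z [a [b [[x y] t]]]]; rewrite /P /=.
move=> /and4P[/setDP[zZ1 _] /setIP[+ aA] /setIP[+ bA]].
have zZ : z \in Z by move: zZ1; rewrite inE => /andP[].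
rewrite !in_set => za zb; rewrite /h /=.
move=> /andP[/and5P[un a1 a2 a3 /andP[a4 a5]] /and5P[xX yX tX nD /andP[xa yb]]].
have zn u : u \in X -> u != z.
  by move=> uX; apply: contraTneq zZ => <-; rewrite (disjointFr dXZ uX).
have za' u : u \in A -> u != z.
  move=> uA; apply: contraTneq zZ => <-; rewrite (disjointFr dAZ) //.
  exact: (subsetP AA0).
rewrite !ffunE !(tnth_nth x) /= nD xa yb [adj D a z]adjC za [adj D b z]adjC zb !andbT.
apply/andP; split.
  apply/injectiveP; apply: ffun_tuple_injective; rewrite /=.
  by move: un; rewrite /= !inE !negb_or (zn x) ?(zn y) ?(zn t) ?(za' a) ?(za' b) ?andbT.
apply: sub_pairs_edges => _ /imsetP[l lL ->].
have [za1 zb1] : adj G a z /\ adj G b z by split; rewrite adjC; apply: adjS DG _.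
move: lL; rewrite !inE => /orP[|/orP[|/orP[|/orP[|/orP[|/orP[|]]]]]] /eqP -> /=;
  rewrite !ffunE !(tnth_nth x) /=; eexists; eexists; split; try reflexivity; done.
Qed.

Lemma no_extension G1 G2 c k (s : {ffun 'I_6 -> V}) :
  extendable G1 G2 c -> s \in bad_copies G1 (colour_class G1 c k) ->
  ~~ (copy Lq s \subset G2).
Proof.
move=> /existsP[d /andP[/forall_inP dc nm]]; rewrite inE.
set D := colour_class G1 c k; move=> /and5P[/injectiveP si sG nxy xa /and3P[az yb bz]].
apply/negP => sG2; set G := G1 :|: G2 in nm.
have inG (H : graph n) u v : H \subset G -> adj H u v -> adj G u v by exact: adjS.
have ne i j : i != j -> s i != s j by rewrite (inj_eq si).
have edge_in L (H : graph n) i j : (i, j) \in L -> i != j -> copy L s \subset H -> adj H (s i) (s j).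
  move=> ijL ij; apply: pairs_edges_sub; first exact: ne.
  by apply/imsetP; exists (i, j).
have Dd u v : adj D u v -> adj (colour_class G d k) u v.
  move=> /exists_inP[e]; rewrite inE => /andP[eG ce] uv; apply/exists_inP; exists e => //.
  by rewrite !inE eG /= (eqP (dc e eG)).
have GG1 : G1 \subset G by exact: subsetUl.
have GG2 : G2 \subset G by exact: subsetUr.
have force u v w : adj D u v -> adj D v w -> adj G u w ->
    adj (colour_class G d (~~ k)) u w.
  move=> uv vw uw; apply: adj_colour => //; apply/negP => uwk.
  by move: nm; apply/negP; apply: (mono_triangleP (Dd _ _ uv) uwk (Dd _ _ vw)).
have xz : adj (colour_class G d (~~ k)) (s vx) (s vz).
  by apply: force xa az _; apply: (inG G2) => //; apply: (edge_in Lq).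
have yz : adj (colour_class G d (~~ k)) (s vy) (s vz).
  by apply: force yb bz _; apply: (inG G2) => //; apply: (edge_in Lq).
have xy : adj (colour_class G d (~~ k)) (s vx) (s vy).
  have xy1 : adj (colour_class G1 c (~~ k)) (s vx) (s vy).
    by apply: adj_colour => //; apply: (edge_in Lp).
  move: xy1 => /exists_inP[e]; rewrite inE => /andP[eG ce] uv; apply/exists_inP; exists e => //.
  by rewrite !inE eG /= (eqP (dc e eG)).
by move: nm; apply/negP; apply: (mono_triangleP xy xz yz).
Qed.

(** If the colouring is extendable, no bad copy has both edges of [Lq] in the second graph, so their
    number is zero, below half of a positive mean. Chebyshev's inequality applies, with correlated
    pairs bounded by [pair_count]. *)
Lemma extendable_prob q G1 c k : 0 <= q <= 1 ->
  Ex q (fun G2 => (extendable G1 G2 c)%:R) *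
    (#|bad_copies G1 (colour_class G1 c k)|%:R * q ^+ 2) ^+ 2 <= 4 * pair_count q G1.
Proof.
move=> q01; have /andP[q0 q1] := q01; set B := bad_copies _ _.
have cpq s : s \in B -> #|copy Lq s| = 2%N.
  by rewrite inE => /andP[/injectiveP si _]; apply: card_copy.
have muE : #|B|%:R * q ^+ 2 = \sum_(s in B) q ^+ #|copy Lq s|.
  by rewrite mulr_natl -sumr_const; apply: eq_bigr => s /cpq ->.
rewrite muE; set mu := \sum_(s in B) _.
have mu0 : 0 <= mu by apply: sumr_ge0 => *; apply: exprn_ge0.
have pc0 : 0 <= pair_count q G1.
  by apply: sumr_ge0 => *; apply: sumr_ge0 => *; rewrite !mulr_ge0 ?exprn_ge0.
have [mu00|mun] := eqVneq mu 0.
  by rewrite mu00 expr0n mulr0 mulr_ge0.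
have mup : 0 < mu by rewrite lt_neqAle eq_sym mun.
apply: le_trans (le_trans (chebyshev_sub (mem B) (copy Lq) q01) _).
  apply: ler_wpM2r; first exact: sqr_ge0.
  apply: le_Ex => // G2; case: (boolP (extendable _ _ _)) => [ex|] //=.
  rewrite big1 => [|s sB]; last by rewrite (negbTE (no_extension ex sB)).
  by rewrite divr_gt0.
rewrite ler_wpM2l // (exchange_big_dep (mem B)) /=; last first.
  by move=> i j _ /andP[].
rewrite big_mkcond [X in _ <= X]big_mkcond; apply: ler_sum => s' _.
have t0 s : 0 <= (copy Lp s \subset G1)%:R * (copy Lp s' \subset G1)%:R *
     q ^+ #|copy Lq s :|: copy Lq s'| by rewrite !mulr_ge0 ?exprn_ge0.
case: ifP => [s'B|_]; last by case: ifP => // _; apply: sumr_ge0.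
move: (s'B); rewrite inE => /and3P[si' sG' _]; rewrite si'.
rewrite big_mkcond [X in _ <= X]big_mkcond; apply: ler_sum => s _.
case: ifP => [/and3P[sB _ ds]|_]; last by case: ifP.
move: (sB); rewrite inE => /and3P[si sG _]; rewrite si sG sG' !mul1r /=.
have -> : common_q_edge (overlap s s') => //.
move: ds; rewrite -setI_eq0 => /set0Pn[e]; rewrite !inE.
move=> /andP[/imsetP[l lL ->] /imsetP[l' _ /setP E]].
have cod i : i \in [:: l.1; l.2] -> s i \in codom s'.
  move=> il; have := E (s i).
  have -> : s i \in [set s l.1; s l.2].
    by move: il; rewrite !inE => /orP[]/eqP->; rewrite eqxx ?orbT.
  by rewrite !inE => /esym/orP[]/eqP ->; apply: codom_f.
have := cod l.1; have := cod l.2; rewrite !inE !eqxx orbT => /(_ isT) c2 /(_ isT) c1.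
rewrite /common_q_edge !inE; move: lL; rewrite !inE => /orP[]/eqP lE; move: c1 c2; rewrite lE /=.
  by move=> -> ->.
by move=> -> ->; rewrite orbT.
Qed.

(** The extreme overlaps are [x], [a], [z] (or [y], [b], [z]), which give [N ^+ 3 * p ^+ 5 * q], and
    the full one, which gives 1; the facts [m1] to [m3] and [g0] to [g5] reduce the other cases to
    them. The factor is [2 ^ 6] overlaps times [6 ^ 6]. *)
Lemma Ex_pair_count p q : 0 <= p <= 1 -> 0 <= q <= 1 -> 1 <= N * p -> N * p ^+ 2 <= 1 ->
  Ex p (pair_count q) <=
  12 ^+ 6 * (N ^+ 6 * p ^+ 7 * q ^+ 2 * (N ^+ 3 * p ^+ 5 * q + 1)).
Proof.
move=> p01 q01 np1 np2; have /andP[p0 p1] := p01; have /andP[q0 q1] := q01.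
have sp : simple Lp by [].
have sq : simple Lq by [].
apply: le_trans (Ex_copy_pairs n common_q_edge p01 q01 sp sq) _.
have N0 : 0 <= N by [].
have N1 : 1 <= N by apply: le_trans np1 _; rewrite ler_piMr.
set M := n%:R in np1 np2 N0 N1 *.
set B := M ^+ 3 * p ^+ 5 * q.
have B0 : 0 <= B by rewrite /B !mulr_ge0 ?exprn_ge0.
have np0 : 0 <= M * p - 1 by rewrite subr_ge0.
have np20 : 0 <= 1 - M * p ^+ 2 by rewrite subr_ge0.
have le1 i j : M ^+ i * p ^+ j * (M * p ^+ 2) <= M ^+ i * p ^+ j.
  by rewrite -[X in _ <= X]mulr1 ler_wpM2l ?mulr_ge0 ?exprn_ge0.
have m1 : M * p ^+ 2 <= 1 by [].
have m2 : M ^+ 2 * p ^+ 4 <= 1 by have := le1 1%N 2%N; lra.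
have m3 : M ^+ 3 * p ^+ 6 <= 1 by have := le1 2%N 4%N; lra.
have g0 : M ^+ 3 * p ^+ 5 * q <= B by [].
have g1 : M ^+ 4 * p ^+ 7 * q <= B.
  by have := ler_wpM2r q0 (le1 3%N 5%N); rewrite /B; lra.
have g2 : M ^+ 3 * p ^+ 6 * q <= B.
  have : 0 <= M ^+ 3 * p ^+ 5 * q * (1 - p) by rewrite mulr_ge0 ?subr_ge0.
  by rewrite /B; lra.
have g3 : M ^+ 2 * p ^+ 4 * q <= B.
  have : 0 <= M ^+ 2 * p ^+ 4 * q * (M * p - 1) by rewrite !mulr_ge0 ?exprn_ge0.
  by rewrite /B; lra.
have g4 : M ^+ 2 * p ^+ 5 * q <= B.
  have : 0 <= M ^+ 2 * p ^+ 4 * q * (1 - p) by rewrite !mulr_ge0 ?exprn_ge0 ?subr_ge0.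
  lra.
have g5 : M * p ^+ 3 * q <= B.
  have : 0 <= M * p ^+ 3 * q * (M * p - 1) by rewrite !mulr_ge0 ?exprn_ge0.
  lra.
have bd O : common_q_edge O -> (\prod_i (if i \in O then 6 else M)) *
    outer_weight p Lp O * outer_weight q Lq O <= 6 ^+ 6 * (B + 1).
  rewrite /common_q_edge prodr_ord6 /outer_weight !big_cons !big_nil /=.
  case: (vz \in O) => //=.
  case: (vx \in O); case: (vy \in O) => //= _; case: (vt \in O); case: (va \in O);
    case: (vb \in O) => /=; lra.
rewrite [X in _ <= X](_ : _ = M ^+ 6 * p ^+ 7 * q ^+ 2 * (12 ^+ 6 * (B + 1))); last by ring.
apply: ler_wpM2l; first by rewrite !mulr_ge0 ?exprn_ge0.
apply: (@le_trans _ _ (\sum_(O : {set 'I_6}) 6 ^+ 6 * (B + 1))).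
  rewrite big_mkcond; apply: ler_sum => O _; case: ifP => [/bd|_] //.
  by rewrite mulr_ge0 ?exprn_ge0 ?addr_ge0.
rewrite sumr_const (_ : #|_| = 64%N); last first.
  by rewrite -cardsT -powersetT card_powerset cardsT card_ord.
rewrite -mulr_natr; lra.
Qed.

End BadCopies.

(** * Choice of the constants *)

Section Assembly.
Variables (R : realType) (C : R).
Hypothesis C0 : 0 < C.

(* [b0] is large enough for [exp (- b0 n p)] raised to the power [gam n] to beat the
   number [2 ^ (C n^2 p)] of colourings; [eta] is then the density down to which the
   weights have to be spread. *)
Let a0 : R := 1 / 180.
Let c0 : R := 1 / 50.
Let c2 : R := a0 * c0 / 2.
Let gam : R := a0 ^+ 2 * c0 ^+ 2 / (8 * C).
Let b0 : R := (C + 3) / gam.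
Let l : R := 4 * (2 + b0) / c2.
Let eta : R := expR (- l).
Let eta1 : R := eta ^+ 2 * c0 ^+ 2 / (16 * C).
Let c1 : R := eta * c0 / 2.
Let kap : R := eta1 ^+ 3 * c1 ^+ 2 / 96.

(** Coefficient of [N ^+ 6 * p ^+ 7] in [gam * N * (theta * s / 4)], the lower bound from
    [many_bad_copies]. *)
Definition bad_constant : R := gam * c2 ^+ 2 * kap / 64.

(** A sum of all thresholds needed below, so that one lower bound on [N ^+ 2 * p ^+ 3] implies each.
    The first summand is the threshold of [not_dense_pairs] for [eta = 1 / 40]. *)
Definition large_constant : R :=
  160 * expR 320 + 4 * expR (8 / eta1) / eta1 +
  expR (10 / eta1) * (16 / eta1 ^+ 2 + 128 * C / eta1 ^+ 4) +
  2 / c1 + 2 / eta1 + 256 * C / (c2 * kap ^+ 2) + 20.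

Lemma constants_gt0 : [/\ 0 < c2, 0 < gam, 0 < b0, 0 < l & 0 < eta] /\
  [/\ 0 < eta1, 0 < c1 & 0 < kap].
Proof.
have c20 : 0 < c2 by rewrite /c2 /a0 /c0; lra.
have gam0 : 0 < gam.
  by apply: divr_gt0; [rewrite /a0 /c0; lra|apply: mulr_gt0].
have b00 : 0 < b0 by apply: divr_gt0 => //; rewrite addr_gt0.
have l0 : 0 < l by apply: divr_gt0 => //; apply: mulr_gt0 => //; rewrite addr_gt0.
have eta0 : 0 < eta by exact: expR_gt0.
have c00 : 0 < c0 by rewrite /c0; lra.
have eta10 : 0 < eta1.
  by apply: divr_gt0; apply: mulr_gt0 => //; exact: exprn_gt0.
have c10 : 0 < c1 by apply: divr_gt0 => //; exact: mulr_gt0.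
by do 2 split=> //; apply: divr_gt0 => //; apply: mulr_gt0; exact: exprn_gt0.
Qed.

Lemma bad_constant_gt0 : 0 < bad_constant.
Proof.
have [[c20 gam0 _ _ _] [_ _ kap0]] := constants_gt0.
by apply: divr_gt0 => //; do 2 (apply: mulr_gt0 => //); exact: exprn_gt0.
Qed.

Section Fixed.
Variables (n : nat) (p : R).
Local Notation N := (n%:R : R).
Hypothesis p01 : 0 <= p <= 1.
Hypothesis np2 : N * p ^+ 2 <= 1.
Hypothesis large : large_constant <= N ^+ 2 * p ^+ 3.

Let g : R := kap * (N ^+ 4 * p ^+ 5) / 2.
Let theta : R := c2 * kap / 16 * (N ^+ 4 * p ^+ 6).
Let s : R := c2 * (N * p).

Definition light_event (i j : nat) (G : graph n) : bool :=
  many_light (residue n i) (residue n j) (residue n 3) theta g (eta * N) s (gam * N)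
    (C * (N ^+ 2 * p)) G.

(** All summands are nonnegative, and [N ^+ 2 * p ^+ 3] is at most [N * p] because
    [N * p ^+ 2 <= 1], and at most [N ^+ 4 * p ^+ 6] because it exceeds 1. *)
Lemma large_parts : [/\ 160 * expR 320 <= N * p, 4 * expR (8 / eta1) / eta1 <= N * p,
    expR (10 / eta1) * (16 / eta1 ^+ 2 + 128 * C / eta1 ^+ 4) <= N ^+ 2 * p ^+ 3,
    2 / c1 <= N * p & 2 / eta1 <= N] /\
  [/\ 256 * C / (c2 * kap ^+ 2) <= N * p, 256 * C / (c2 * kap ^+ 2) <= N ^+ 4 * p ^+ 6,
    20 <= N & 0 < p].
Proof.
have [[c20 gam0 b00 l0 eta0] [eta10 c10 kap0]] := constants_gt0.
have /andP[p0 p1] := p01; have N0 : 0 <= N by [].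
have h1 : 0 <= 160 * expR 320 :> R by rewrite mulr_ge0 ?expR_ge0.
have h2 : 0 <= 4 * expR (8 / eta1) / eta1.
  by apply: divr_ge0; [rewrite mulr_ge0 ?expR_ge0|exact: ltW].
have h3 : 0 <= expR (10 / eta1) * (16 / eta1 ^+ 2 + 128 * C / eta1 ^+ 4).
  rewrite mulr_ge0 ?expR_ge0 // addr_ge0 //; apply: divr_ge0 => //.
  - by apply: exprn_ge0; exact: ltW.
  - by apply: mulr_ge0 => //; exact: ltW.
  - by apply: exprn_ge0; exact: ltW.
have h4 : 0 <= 2 / c1 by apply: divr_ge0 => //; exact: ltW.
have h5 : 0 <= 2 / eta1 by apply: divr_ge0 => //; exact: ltW.
have h6 : 0 <= 256 * C / (c2 * kap ^+ 2).
  by apply: divr_ge0; apply: mulr_ge0 => //; [exact: ltW|exact: ltW|exact: sqr_ge0].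
have X20 : 20 <= N ^+ 2 * p ^+ 3 by move: large; rewrite /large_constant; lra.
have XNp : N ^+ 2 * p ^+ 3 <= N * p.
  have : 0 <= N * p * (1 - N * p ^+ 2) by rewrite !mulr_ge0 ?subr_ge0.
  lra.
have NpN : N * p <= N by rewrite ler_piMr.
have XX : N ^+ 2 * p ^+ 3 <= N ^+ 4 * p ^+ 6.
  have : 0 <= N ^+ 2 * p ^+ 3 * (N ^+ 2 * p ^+ 3 - 1) by rewrite mulr_ge0 //; lra.
  lra.
have pp : 0 < p.
  rewrite lt_neqAle p0 andbT; apply/eqP => p00; move: X20; rewrite -p00; lra.
move: large; rewrite /large_constant; move: h1 h2 h3 h4 h5 h6.
set x1 := 160 * _; set x2 := 4 * expR _ / _; set x3 := expR _ * _; set x4 := 2 / c1.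
set x5 := 2 / eta1; set x6 := 256 * C / _ => *.
by do 2 split => //; lra.
Qed.

Lemma theta_gt0 : 0 < theta.
Proof.
have [[c20 _ _ _ _] [_ _ kap0]] := constants_gt0; have [_ [_ _ N20 pp]] := large_parts.
have N0 : 0 < N by apply: lt_le_trans N20.
by apply: mulr_gt0; [apply: divr_gt0 => //; apply: mulr_gt0|apply: mulr_gt0; apply: exprn_gt0].
Qed.

Lemma light_event_prob i j : i != j -> (j < 3)%N ->
  Ex p (fun G => (light_event i j G)%:R) <= expR (- N).
Proof.
move=> ij j3.
have [[c20 gam0 b00 l0 eta0] [eta10 c10 kap0]] := constants_gt0.
have [_ [_ _ N20 pp]] := large_parts.
have [[h1 h2 h3 h4 h5] _] := large_parts.
have N0 : 0 < N by apply: lt_le_trans N20.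
have Np1 : 1 <= N * p.
  by apply: le_trans h1; have := expR_ge1Dx (320 : R); lra.
have g0 : 0 < g.
  by apply: divr_gt0 => //; apply: mulr_gt0 => //; apply: mulr_gt0; apply: exprn_gt0.
have dis : [disjoint residue n j & residue n 3].
  by apply: residue_disjoint; rewrite neq_ltn j3.
have en0 : 0 < eta * N by exact: mulr_gt0.
have bp0 : 0 <= b0 * (N * p).
  by apply: mulr_ge0; [exact: ltW|apply: mulr_ge0; exact: ltW].
rewrite /light_event.
(* The value [k = c2 * (N * p) / 8] makes [theta * N] equal to [k * g]. *)
apply: le_trans (@not_many_light R n p (residue n i) (residue n j) (residue n 3) theta g
  (eta * N) s (gam * N) (C * (N ^+ 2 * p)) (c2 * (N * p) / 8) l _ p01 dis theta_gt0 g0 en0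
  (ltW l0) bp0 _ _) _.
- by rewrite /theta /g; lra.
(* The first term is [- (2 + b0) * (N * p)] by the choice of [l]; the other two are at most [N * p]
   each, the last because [eta = expR (- l)]. *)
- have e1 : eta <= 1 by rewrite /eta -[X in _ <= X]expR0 ler_expR oppr_le0 ltW.
  have lc2 : l * c2 = 4 * (2 + b0) by rewrite /l divfK // gt_eqF.
  have -> : expR l * p * (eta * N) = N * p.
    have : expR l * eta = 1 by rewrite /eta -expRD subrr expR0.
    by move=> ee; transitivity (expR l * eta * (N * p)); [ring|rewrite ee mul1r].
  have -> : l * (2 * (c2 * (N * p) / 8) - s / 2) = - (l * c2) * (N * p) / 4.
    by rewrite /s; field.
  rewrite lc2 -/eta.
  have : 0 <= (1 - eta) * (N * p) by rewrite mulr_ge0 ?subr_ge0 // ltW // mulr_gt0.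
  lra.
(* The gain [(C + 3) * (N ^+ 2 * p)] exceeds the cost of the colour classes by at least [3 * N],
   enough for the two factors [2 ^+ n] and the claimed [expR (- N)]. *)
- have bg : b0 * (N * p) * (gam * N) = (C + 3) * (N ^+ 2 * p).
    by rewrite /b0; field; rewrite gt_eqF.
  rewrite bg; have e2 := expR_two R n; have e0 : (0 : R) <= 2 ^+ n by rewrite exprn_ge0.
  apply: (@le_trans _ _ (expR (C * (N ^+ 2 * p)) * expR N *
     (expR N * expR (- ((C + 3) * (N ^+ 2 * p)))))).
    apply: ler_pM; rewrite ?mulr_ge0 ?expR_ge0 //.
      by rewrite ler_wpM2l ?expR_ge0.
    by rewrite ler_wpM2r ?expR_ge0.
  rewrite -!expRD ler_expR.
  have : 0 <= N * (N * p - 1) by rewrite mulr_ge0 ?subr_ge0 // ltW.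
  lra.
Qed.

(** The conditions on [G] do not mention the colouring, so one typical graph serves all colourings
    and [c] may be chosen after seeing it. *)
Lemma bad_copies_ge (G : graph n) (c : colouring n) :
  #|G|%:R <= C * (N ^+ 2 * p) ->
  \sum_x #|nbr G x|%:R ^+ 2 <= C * (N ^+ 3 * p ^+ 2) ->
  \sum_a \sum_b #|confs G a b|%:R ^+ 2 <= C * (N ^+ 5 * p ^+ 5 * (N ^+ 3 * p ^+ 5 + 1)) ->
  dense_pairs p (1 / 40) G -> rich_triangles p eta1 G ->
  (forall i j, (i < 3)%N -> (j < 3)%N -> i != j -> ~~ light_event i j G) ->
  no_mono_triangle G c ->
  exists k, bad_constant * (N ^+ 6 * p ^+ 7) <= #|bad_copies G (colour_class G c k)|%:R.
Proof.
move=> G1 G2 G3 G4 G5 G6 nm.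
have [[c20 gam0 b00 l0 eta0] [eta10 c10 kap0]] := constants_gt0.
have [[_ _ _ h4 h5] [h6 h7 N20 pp]] := large_parts.
have N0 : 0 < N by apply: lt_le_trans N20.
have n20 : (20 <= n)%N by rewrite -(ler_nat R).
have [i [j [k [A [/and3P[i3 j3 ij] A3 Abig hi hj]]]]] := common_majority c pp n20 G4.
exists k; set D := colour_class G c k.
have DG : D \subset G by exact: colour_class_sub.
have tf x y t : adj D x y -> adj D x t -> adj D y t -> False.
  by move=> a1 a2 a3; move: nm; apply/negP; apply: mono_triangleP a1 a2 a3.
have ne3 u : (u < 3)%N -> u != 3%N by move=> u3; rewrite neq_ltn u3.
have dXZ : [disjoint residue n i & residue n j] by apply: residue_disjoint.
have dXA : [disjoint residue n i & residue n 3] by apply/residue_disjoint/ne3.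
have dAZ : [disjoint residue n 3 & residue n j].
  by rewrite disjoint_sym; apply/residue_disjoint/ne3.
have LD : spread G D (residue n i) A theta g (eta * N).
  apply: (@spread_of_rich R n p G D (residue n i) A eta c0 C theta) => //.
  - exact: disjointWr A3 dXA.
  - by rewrite /c0; lra.
  - exact: theta_gt0.
  - by rewrite -/c1 mulrC -ler_pdivrMr.
  - by rewrite -/eta1 mulrC -ler_pdivrMr.
  - rewrite -/eta1 -/c1 -/kap /theta.
    have ck : 0 < c2 * kap ^+ 2 by apply: mulr_gt0 => //; exact: exprn_gt0.
    move: h6 h7; rewrite !ler_pdivrMr // => h6 h7.
    have := ler_wpM2r (_ : 0 <= N ^+ 3 * p ^+ 5) h6.
    rewrite mulr_ge0 ?exprn_ge0 ?(ltW pp) // => /(_ isT); lra.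
(* The constant [gam] is chosen so that [many_large_values] yields [2 * (gam * N)] vertices, of
   which fewer than half are light. *)
have hz : 2 * (gam * N) <= #|[set z in residue n j | (s <= #|nbr D z :&: A|%:R)%R]|%:R.
  pose f z : R := #|nbr D z :&: A|%:R.
  have S1 : a0 * N * (c0 * (N * p)) <= \sum_(z in residue n j) f z.
    rewrite sum_nbr_exchange; apply: (@le_trans _ _ (\sum_(a in A) c0 * (N * p))).
      rewrite sumr_const -[X in _ <= X]mulr_natl ler_wpM2r //; last by rewrite /a0; lra.
      by rewrite /c0 !mulr_ge0 // ltW.
    by apply: ler_sum => a aA; apply: hj.
  have S2 : \sum_z f z ^+ 2 <= C * (N ^+ 3 * p ^+ 2).
    apply: le_trans G2; apply: ler_sum => x _; apply: lerXn2r; rewrite ?nnegrE //.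
    rewrite ler_nat subset_leq_card //; apply: subset_trans (subsetIl _ _) _.
    by apply/subsetP => y; rewrite !inE; apply: adjS.
  have Np0 : 0 <= N * p by rewrite mulr_ge0 // ltW.
  have : (a0 * N * (c0 * (N * p)) / 2) ^+ 2 <=
      #|[set z in residue n j | (s <= f z)%R]|%:R * (C * (N ^+ 3 * p ^+ 2)).
    apply: many_large_values S1 S2 => //.
    - by rewrite /a0 /c0 !mulr_ge0 // ltW.
    - by rewrite /s /c2; lra.
    - by rewrite /s mulr_ge0 // ltW.
  have T0 : 0 < N ^+ 3 * p ^+ 2 by rewrite mulr_gt0 ?exprn_gt0.
  have -> : (a0 * N * (c0 * (N * p)) / 2) ^+ 2 = 2 * (gam * N) * C * (N ^+ 3 * p ^+ 2).
    by rewrite /gam; field; rewrite gt_eqF.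
  by rewrite [X in _ <= X -> _]mulrA (ler_pM2r T0) (ler_pM2r C0).
apply: le_trans (many_bad_copies DG dXZ dAZ dXA A3 _ _ G1 LD (G6 i j i3 j3 ij) hz).
- by rewrite /bad_constant /theta /s; lra.
- exact: ltW theta_gt0.
- by rewrite /s !mulr_ge0 // ltW.
Qed.

Lemma markov_ratio (f : graph n -> R) (t K : R) : 0 < t -> (forall G, 0 <= f G) ->
  Ex p f <= K * t -> Ex p (fun G => (C * t <= f G)%R%:R) <= K / C.
Proof.
move=> t0 f0 fK; rewrite ler_pdivlMr // -(ler_pM2r t0) -mulrA mulrC.
exact: le_trans (markov_Ex _ p01 f0) fK.
Qed.

(** Union bound over the exceptional first graphs. The Markov events cost
    [(1 + 2 + 10 ^+ 5 + 12 ^+ 6) / C], the others [(1 + 1 + 1 + 9) * expR (- N)]; the last summand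
    is the second moment bound over [G2]. *)
Lemma extension_prob_le q (phi : graph n -> colouring n) : 0 <= q <= 1 -> 0 < q ->
  Ex p (fun G1 => Ex q (fun G2 =>
    (no_mono_triangle G1 (phi G1) && extendable G1 G2 (phi G1))%:R)) <=
  4 * 10 ^+ 6 / C + 12 * expR (- N) +
  4 * (C * (N ^+ 6 * p ^+ 7 * q ^+ 2 * (N ^+ 3 * p ^+ 5 * q + 1))) /
    (bad_constant * (N ^+ 6 * p ^+ 7) * q ^+ 2) ^+ 2.
Proof.
move=> q01 q0.
have [[c20 gam0 b00 l0 eta0] [eta10 c10 kap0]] := constants_gt0.
have [[h1 h2 h3 h4 h5] [h6 h7 N20 pp]] := large_parts.
have N0 : 0 < N by apply: lt_le_trans N20.
have Np1 : 1 <= N * p.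
  by apply: le_trans h1; have := expR_ge1Dx (320 : R); lra.
set last := (X in _ <= _ + X).
have T67 : 0 < N ^+ 6 * p ^+ 7 by apply: mulr_gt0; exact: exprn_gt0.
have T35 : 0 < N ^+ 3 * p ^+ 5 by apply: mulr_gt0; exact: exprn_gt0.
have T55 : 0 < N ^+ 5 * p ^+ 5 by apply: mulr_gt0; exact: exprn_gt0.
have T32 : 0 < N ^+ 3 * p ^+ 2 by apply: mulr_gt0; exact: exprn_gt0.
have T21 : 0 < N ^+ 2 * p by apply: mulr_gt0 => //; exact: exprn_gt0.
have bc0 := bad_constant_gt0.
pose t3 : R := N ^+ 5 * p ^+ 5 * (N ^+ 3 * p ^+ 5 + 1).
pose t8 : R := N ^+ 6 * p ^+ 7 * q ^+ 2 * (N ^+ 3 * p ^+ 5 * q + 1).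
have t30 : 0 < t3 by apply: mulr_gt0 => //; apply: addr_gt0.
have t80 : 0 < t8.
  apply: mulr_gt0; first by apply: mulr_gt0 => //; exact: exprn_gt0.
  by apply: addr_gt0 => //; exact: mulr_gt0.
pose deg2 (G : graph n) : R := \sum_x #|nbr G x|%:R ^+ 2.
pose conf2 (G : graph n) : R := \sum_a \sum_b #|confs G a b|%:R ^+ 2.
pose i1 (G : graph n) : R := (C * (N ^+ 2 * p) <= #|G|%:R)%R%:R.
pose i2 (G : graph n) : R := (C * (N ^+ 3 * p ^+ 2) <= deg2 G)%R%:R.
pose i3 (G : graph n) : R := (C * t3 <= conf2 G)%R%:R.
pose i4 (G : graph n) : R := (~~ dense_pairs p (1 / 40) G)%:R.
pose i5 (G : graph n) : R := (~~ dense_pairs p eta1 G)%:R.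
pose i6 (G : graph n) : R := [&& dense_pairs p eta1 G, (deg2 G <= C * (N ^+ 3 * p ^+ 2))%R &
     ~~ rich_triangles p eta1 G]%:R.
pose i7 (G : graph n) : R := \sum_(t : 'I_3 * 'I_3 | t.1 != t.2) (light_event t.1 t.2 G)%:R.
pose i8 (G : graph n) : R := (C * t8 <= pair_count q G)%R%:R.
have deg20 (G : graph n) : 0 <= deg2 G by apply: sumr_ge0 => *; apply: sqr_ge0.
have conf20 (G : graph n) : 0 <= conf2 G by do 2 (apply: sumr_ge0 => ? _); apply: sqr_ge0.
have pc0 (G : graph n) : 0 <= pair_count q G.
  by do 2 (apply: sumr_ge0 => ? _); rewrite !mulr_ge0 ?exprn_ge0 // ltW.
have last0 : 0 <= last.
  apply: divr_ge0; last exact: sqr_ge0.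
  by apply: mulr_ge0 => //; apply: mulr_ge0; exact: ltW.
have E1 : Ex p i1 <= 1 / C by apply: markov_ratio => //; rewrite mul1r Ex_card.
have E2 : Ex p i2 <= 2 / C by apply: markov_ratio => //; rewrite mulrA Ex_sum_deg2.
have E3 : Ex p i3 <= 10 ^+ 5 / C by apply: markov_ratio => //; apply: Ex_confs2.
have E4 : Ex p i4 <= expR (- N).
  apply: not_dense_pairs => //.
  by rewrite (_ : 8 / (1 / 40) = 320); [lra|field].
have E5 : Ex p i5 <= expR (- N).
  by apply: not_dense_pairs => //; rewrite [X in _ <= X]mulrC -ler_pdivrMr.
have E6 : Ex p i6 <= expR (- N).
  by apply: not_rich_triangles => //; exact: ltW.
have E7 : Ex p i7 <= 9 * expR (- N).
  rewrite Ex_sum; apply: (@le_trans _ _ (\sum_(t : 'I_3 * 'I_3) expR (- N))).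
    rewrite big_mkcond; apply: ler_sum => t _; case: ifP => [t12|_]; last exact: expR_ge0.
    exact: light_event_prob.
  by rewrite sumr_const card_prod !card_ord -[X in X <= _]mulr_natl.
have E8 : Ex p i8 <= 12 ^+ 6 / C.
  by apply: markov_ratio => //; apply: Ex_pair_count.
(* An exceptional event makes a summand at least 1, which suffices as [L <= 1]; outside all of them
   [L <= last]. *)
have main (G : graph n) : Ex q (fun G2 => (no_mono_triangle G (phi G) && extendable G G2 (phi G))%:R) <=
    i1 G + (i2 G + (i3 G + (i4 G + (i5 G + (i6 G + (i7 G + (i8 G + last))))))).
  clear h1 h2 h3 h4 h5 h6 h7 Np1 E1 E2 E3 E4 E5 E6 E7 E8; set L := Ex q _.
  have L1 : L <= 1.
    rewrite -(Ex_cst n q 1); apply: le_Ex => // G2; case: (_ && _) => //=.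
  have i70 : 0 <= i7 G by apply: sumr_ge0.
  have [j1 j2 j3 j4] : [/\ 0 <= i1 G, 0 <= i2 G, 0 <= i3 G & 0 <= i4 G] by [].
  have [j5 j6 j8] : [/\ 0 <= i5 G, 0 <= i6 G & 0 <= i8 G] by [].
  case: (lerP (C * (N ^+ 2 * p)) #|G|%:R) => [b1|/ltW b1].
    have e1 : i1 G = 1 by rewrite /i1 b1.
    lra.
  case: (lerP (C * (N ^+ 3 * p ^+ 2)) (deg2 G)) => [b2|/ltW b2].
    have e2 : i2 G = 1 by rewrite /i2 b2.
    lra.
  case: (lerP (C * t3) (conf2 G)) => [b3|/ltW b3].
    have e3 : i3 G = 1 by rewrite /i3 b3.
    lra.
  case: (boolP (dense_pairs p (1 / 40) G)) => [b4|b4]; last first.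
    have e4 : i4 G = 1 by rewrite /i4 b4.
    lra.
  case: (boolP (dense_pairs p eta1 G)) => [b5|b5]; last first.
    have e5 : i5 G = 1 by rewrite /i5 b5.
    lra.
  case: (boolP (rich_triangles p eta1 G)) => [b6|b6]; last first.
    have e6 : i6 G = 1 by rewrite /i6 b5 b2 b6.
    lra.
  case: (lerP (C * t8) (pair_count q G)) => [b8|/ltW b8].
    have e8 : i8 G = 1 by rewrite /i8 b8.
    lra.
  case: (boolP [exists t : 'I_3 * 'I_3, (t.1 != t.2) && light_event t.1 t.2 G]).
    move=> /existsP[t /andP[t12 lt]].
    have : 1 <= i7 G by rewrite /i7 (bigD1 t) //= lt lerDl sumr_ge0.
    lra.
  rewrite negb_exists => /forallP b7.
  suff : L <= last by lra.
  case: (boolP (no_mono_triangle G (phi G))) => [nm|nm]; last first.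
    rewrite (_ : L = 0) //; rewrite -(Ex_cst n q 0); apply: eq_Ex => G2.
    by rewrite (negbTE nm).
  have b7' i j : (i < 3)%N -> (j < 3)%N -> i != j -> ~~ light_event i j G.
    move=> i3' j3' ij; have := b7 (Ordinal i3', Ordinal j3').
    by rewrite negb_and negbK /= => /orP[/eqP[e]|//]; rewrite e eqxx in ij.
  have [k hk] := bad_copies_ge b1 b2 b3 b4 b6 b7' nm.
  have Lq2 : L * (#|bad_copies G (colour_class G (phi G) k)|%:R * q ^+ 2) ^+ 2 <=
      4 * pair_count q G.
    apply: le_trans (extendable_prob G (phi G) k q01); apply: ler_wpM2r; first exact: sqr_ge0.
    by apply: le_Ex => // G2; rewrite nm.
  have bq : 0 < bad_constant * (N ^+ 6 * p ^+ 7) * q ^+ 2.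
    by apply: mulr_gt0; [exact: mulr_gt0|exact: exprn_gt0].
  rewrite /last ler_pdivlMr ?exprn_gt0 //.
  apply: le_trans (ler_wpM2l _ b8) => //; apply: le_trans Lq2.
  apply: ler_wpM2l; first by apply: Ex_ge0.
  apply: lerXn2r; rewrite ?nnegrE ?(ltW bq) //; first by rewrite mulr_ge0 ?exprn_ge0 // ltW.
  by apply: ler_wpM2r hk; rewrite exprn_ge0 // ltW.
apply: le_trans (le_Ex p01 main) _; rewrite !ExD Ex_cst.
have Ci : 0 < C^-1 by rewrite invr_gt0.
lra.
Qed.

End Fixed.
End Assembly.

(** With [T = n ^ 6 * p ^ 7 * q ^ 2] and [B = n ^ 3 * p ^ 5 * q], the second moment term is of order
    [(B + 1) / T], and it is small for large [T] because [B ^+ 2 = T * p ^+ 3] is at most [T]. Each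
    of the three summands gets [eps / 3]. *)
Lemma two_round_bound (R : realType) (eps : R) : 0 < eps -> exists M : R,
  forall (n : nat) (p q : R) (phi : graph n -> colouring n),
    0 <= p <= 1 -> 0 <= q <= 1 -> n%:R * p ^+ 2 <= 1 -> M <= n%:R ^+ 2 * p ^+ 3 ->
    M <= n%:R ^+ 6 * p ^+ 7 * q ^+ 2 ->
    Ex p (fun G1 => Ex q (fun G2 =>
      (no_mono_triangle G1 (phi G1) && extendable G1 G2 (phi G1))%:R)) <= eps.
Proof.
move=> eps0.
have [C C0 h1] : exists2 C : R, 0 < C & 4 * 10 ^+ 6 / C = eps / 3.
  exists (4 * 10 ^+ 6 / (eps / 3)); last by rewrite invf_div mulrC divfK // mulf_neq0 ?expf_neq0.
  by apply: divr_gt0; [apply: mulr_gt0 => //; exact: exprn_gt0|exact: divr_gt0].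
pose c := bad_constant C; have c0 : 0 < c := bad_constant_gt0 C0.
pose m := 24 * C / (c ^+ 2 * eps) + 1.
have c20 : 0 < c ^+ 2 * eps by apply: mulr_gt0 => //; exact: exprn_gt0.
have m1 : 1 <= m.
  by rewrite lerDr; apply: divr_ge0; [apply: mulr_ge0 => //; exact: ltW|exact: ltW].
have m0 : 0 < m by exact: lt_le_trans m1.
(* The three parts serve [extension_prob_le], the bound on [12 * expR (- n%:R)] through
   [expR (- n%:R) <= n%:R^-1], and the inequality [(B + 1) * m <= 2 * T]. *)
exists (Num.max (large_constant C) (Num.max (36 / eps) (m ^+ 2))).
move=> n p q phi p01 q01 np2; rewrite !ge_max => /and3P[X1 X2 _] /and3P[_ _ T1].
have /andP[p0 p1] := p01; have /andP[q0 q1] := q01.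
set T := n%:R ^+ 6 * p ^+ 7 * q ^+ 2 in T1 *.
have T0 : 0 < T by apply: lt_le_trans T1; exact: exprn_gt0.
have qp : 0 < q.
  rewrite lt_neqAle q0 andbT; apply/eqP => q00.
  by move: T0; rewrite /T -q00 expr0n mulr0 ltxx.
apply: le_trans (extension_prob_le C0 p01 np2 X1 phi q01 qp) _.
have Nbig : 36 / eps <= n%:R.
  apply: le_trans X2 _; apply: (@le_trans _ _ (n%:R * p)).
    have : 0 <= n%:R * p * (1 - n%:R * p ^+ 2) by rewrite !mulr_ge0 ?subr_ge0.
    lra.
  by rewrite ler_piMr.
have N0 : 0 < n%:R :> R by apply: lt_le_trans Nbig; rewrite divr_gt0.
have h2 : 12 * expR (- n%:R) <= eps / 3.
  have : expR (- n%:R) <= (n%:R)^-1 :> R.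
    rewrite expRN lef_pV2 ?posrE ?expR_gt0 //; apply: le_trans (expR_ge1Dx _); lra.
  have : (n%:R)^-1 <= eps / 36.
    by rewrite -[eps / 36]invf_div lef_pV2 ?posrE ?divr_gt0.
  lra.
set B := n%:R ^+ 3 * p ^+ 5 * q.
have B0 : 0 <= B by rewrite /B !mulr_ge0 ?exprn_ge0.
have BT : B ^+ 2 <= T.
  have : 0 <= T * (1 - p ^+ 3).
    by rewrite mulr_ge0 ?subr_ge0 ?exprn_ile1 // ltW.
  by rewrite /T /B; lra.
have BmT : (B + 1) * m <= 2 * T.
  have hB : B * m <= T.
    rewrite leNgt; apply/negP => hlt.
    have : T * T < B ^+ 2 * m ^+ 2.
      by rewrite -exprMn -expr2 ltrXn2r // ?nnegrE ?mulr_ge0 // ltW.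
    have := ler_pM (sqr_ge0 B) (sqr_ge0 m) BT T1; lra.
  have : m <= m ^+ 2 by rewrite expr2 ler_peMr // ltW.
  lra.
have h3 : 4 * (C * (T * (B + 1))) / (c * (n%:R ^+ 6 * p ^+ 7) * q ^+ 2) ^+ 2 <= eps / 3.
  have -> : c * (n%:R ^+ 6 * p ^+ 7) * q ^+ 2 = c * T by rewrite /T !mulrA.
  rewrite ler_pdivrMr; last by apply: exprn_gt0; exact: mulr_gt0.
  have hm : 24 * C <= m * (c ^+ 2 * eps).
    by rewrite -ler_pdivrMr // /m lerDl.
  have hB1 : (B + 1) * (24 * C) <= 2 * T * (c ^+ 2 * eps).
    apply: le_trans (ler_wpM2l _ hm) _; first by rewrite addr_ge0.
    rewrite [X in X <= _]mulrA; exact: (ler_wpM2r (ltW c20) BmT).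
  have := ler_wpM2l (ltW T0) hB1; lra.
rewrite h1; apply: le_trans (lerD (lerD (lexx _) h2) h3) _; lra.
Qed.

Lemma gnp2_prE (R : realType) n (p q : R) (A : graph n -> graph n -> bool) :
  gnp2_pr p q A = Ex p (fun G1 => Ex q (fun G2 => (A G1 G2)%:R)).
Proof.
apply: eq_bigr => G1 _; rewrite mulr_sumr big_mkcond; apply: eq_bigr => G2 _.
by case: (A G1 G2); rewrite ?mulr1 ?mulr0.
Qed.

Lemma gnp2_prC (R : realType) n (p q : R) (A : graph n -> graph n -> bool) :
  gnp2_pr p q (fun G1 G2 => ~~ A G1 G2) = 1 - gnp2_pr p q A.
Proof.
rewrite !gnp2_prE; apply: (canRL (addrK _)).
rewrite -ExD -[RHS](Ex_cst n p); apply: eq_Ex => G1.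
rewrite -ExD -[RHS](Ex_cst n q); apply: eq_Ex => G2.
by case: (A G1 G2); rewrite /= ?addr0 ?add0r.
Qed.

Local Open Scope classical_set_scope.
Local Open Scope ring_scope.

(** * Asymptotics *)

Section Asymptotics.
Variables (R : realType) (p q : nat -> R).
Hypotheses (p01 : forall n, 0 <= p n <= 1) (q01 : forall n, 0 <= q n <= 1).

Lemma much_less_le (f g : nat -> R) (d : R) : (forall n, 0 <= g n) -> 0 < d ->
  much_less f g -> \forall n \near \oo, 0 < g n /\ f n <= d * g n.
Proof.
move=> g0 d0 [gn0 /cvgrPdist_le/(_ d d0) fg]; near=> n.
have gn : 0 < g n.
  by rewrite lt_neqAle g0 eq_sym andbT; near: n.
split=> //; rewrite -ler_pdivrMr //; apply: le_trans (ler_norm _) _.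
by rewrite -normrN -sub0r; near: n.
Unshelve. all: by end_near. Qed.

Lemma powR_natr_pow (x r : R) k : 0 <= x -> (x `^ r) ^+ k = x `^ (r * k%:R).
Proof. by move=> x0; rewrite powRrM powR_mulrn ?powR_ge0. Qed.

(** Cubing [n ^ (- 2 / 3) <= d * p] gives [1 <= d ^ 3 * n ^ 2 * p ^ 3]; with [d] the inverse of
    [|M| + 1] one has [d ^ 3 <= d] and [M * d <= 1]. *)
Lemma lower_density (M : R) : much_less (fun n => n%:R `^ (- (2 / 3))) p ->
  \forall n \near \oo, M <= n%:R ^+ 2 * p n ^+ 3.
Proof.
move=> hp; pose d : R := (`|M| + 1)^-1.
have d0 : 0 < d by rewrite invr_gt0 ltr_wpDl.
have p0 n : 0 <= p n by have /andP[] := p01 n.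
near=> n.
have n0 : 0 < n%:R :> R by rewrite ltr0n; near: n; exact: nbhs_infty_gt.
have [pn h] : 0 < p n /\ n%:R `^ (- (2 / 3)) <= d * p n by near: n; exact: much_less_le.
have : (n%:R `^ (- (2 / 3))) ^+ 3 <= (d * p n) ^+ 3.
  by apply: lerXn2r h; rewrite nnegrE ?powR_ge0 // mulr_ge0 // ltW.
rewrite powR_natr_pow // (_ : - (2 / 3) * 3%:R = - 2%:R) ?powRN ?powR_mulrn //; last by field.
rewrite -[X in X <= _]mul1r ler_pdivrMr ?exprn_gt0 // exprMn => h3.
have d1 : d <= 1 by rewrite invf_le1 ?ltr_wpDl // lerDr.
have Md : M * d <= 1.
  by rewrite -/(_ / _) ler_pdivrMr ?ltr_wpDl // mul1r (le_trans (ler_norm _)) // lerDl.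
have X0 : 0 <= n%:R ^+ 2 * p n ^+ 3 by rewrite mulr_ge0 ?exprn_ge0.
have dX : 1 <= d * (n%:R ^+ 2 * p n ^+ 3).
  apply: le_trans h3 _.
  have : d ^+ 3 <= d by rewrite exprS ler_piMr ?exprn_ile1 // ltW.
  by move=> /(ler_wpM2r X0); lra.
rewrite -(ler_pM2r d0); lra.
Unshelve. all: by end_near. Qed.

Lemma upper_density : much_less p (fun n => n%:R `^ (- (1 / 2))) ->
  \forall n \near \oo, n%:R * p n ^+ 2 <= 1.
Proof.
move=> hp; near=> n.
have n0 : 0 < n%:R :> R by rewrite ltr0n; near: n; exact: nbhs_infty_gt.
have /andP[p0 _] := p01 n.
have [_ h] : 0 < n%:R `^ (- (1 / 2)) :> R /\ p n <= 1 * n%:R `^ (- (1 / 2)).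
  by near: n; apply: much_less_le => // n; exact: powR_ge0.
have : p n ^+ 2 <= (n%:R `^ (- (1 / 2))) ^+ 2.
  by apply: lerXn2r; rewrite ?nnegrE ?powR_ge0 // -[X in _ <= X]mul1r.
rewrite powR_natr_pow // (_ : - (1 / 2) * 2%:R = - 1%:R) ?powRN ?powR_mulrn //; last by field.
by rewrite expr1 => h2; apply: le_trans (ler_wpM2l (ltW n0) h2) _; rewrite mulfV ?gt_eqF.
Unshelve. all: by end_near. Qed.

(** Squaring removes the half-integral power and gives [1 <= d ^ 2 * n ^ 6 * p ^ 7 * q ^ 2];
    positivity of [p n] allows multiplication by [p n ^+ 7]. *)
Lemma lower_second_density (M : R) : much_less (fun n => n%:R ^- 3 * p n `^ (- (7 / 2))) q ->
  (\forall n \near \oo, 0 < p n) ->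
  \forall n \near \oo, M <= n%:R ^+ 6 * p n ^+ 7 * q n ^+ 2.
Proof.
move=> hq hp; pose d : R := (`|M| + 1)^-1.
have d0 : 0 < d by rewrite invr_gt0 ltr_wpDl.
have q0 n : 0 <= q n by have /andP[] := q01 n.
near=> n.
have n0 : 0 < n%:R :> R by rewrite ltr0n; near: n; exact: nbhs_infty_gt.
have pn : 0 < p n by near: n.
have pn0 := ltW pn.
have [qn h] : 0 < q n /\ n%:R ^- 3 * p n `^ (- (7 / 2)) <= d * q n.
  by near: n; exact: much_less_le.
have : (n%:R ^- 3 * p n `^ (- (7 / 2))) ^+ 2 <= (d * q n) ^+ 2.
  apply: lerXn2r h; rewrite nnegrE.
    by rewrite mulr_ge0 ?powR_ge0 // invr_ge0 exprn_ge0 // ltW.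
  by rewrite mulr_ge0 // ltW.
rewrite !exprMn powR_natr_pow //.
rewrite (_ : - (7 / 2) * 2%:R = - 7%:R) ?powRN ?powR_mulrn //; last by field.
rewrite exprVn -exprM -invfM => h3.
have {}h3 : 1 <= d ^+ 2 * (n%:R ^+ 6 * p n ^+ 7 * q n ^+ 2).
  have T0 : 0 < n%:R ^+ 6 * p n ^+ 7 :> R by rewrite mulr_gt0 ?exprn_gt0.
  by move: h3; rewrite -[X in X <= _]mul1r ler_pdivrMr //; lra.
have d1 : d <= 1 by rewrite invf_le1 ?ltr_wpDl // lerDr.
have Md : M * d <= 1.
  by rewrite -/(_ / _) ler_pdivrMr ?ltr_wpDl // mul1r (le_trans (ler_norm _)) // lerDl.
have X0 : 0 <= n%:R ^+ 6 * p n ^+ 7 * q n ^+ 2 by rewrite !mulr_ge0 ?exprn_ge0 // ltW.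
have dX : 1 <= d * (n%:R ^+ 6 * p n ^+ 7 * q n ^+ 2).
  apply: le_trans h3 _.
  have : d ^+ 2 <= d by rewrite expr2 ler_piMr // ltW.
  by move=> /(ler_wpM2r X0).
rewrite -(ler_pM2r d0); lra.
Unshelve. all: by end_near. Qed.

End Asymptotics.

Theorem theorem4p6 (R : realType) (p q : nat -> R)
  (p01 : forall n, 0 <= p n <= 1) (q01 : forall n, 0 <= q n <= 1)
  (p_lower : much_less (fun n => n%:R `^ (- (2 / 3))) p)
  (p_upper : much_less p (fun n => n%:R `^ (- (1 / 2))))
  (q_lower : much_less (fun n => n%:R ^- 3 * p n `^ (- (7 / 2))) q)
  (phi : forall n, graph n -> colouring n) :
  gnp2_pr (p n) (q n) (fun G1 G2 : graph n =>
      ~~ (no_mono_triangle G1 (phi n G1) && extendable G1 G2 (phi n G1)))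
    @[n --> \oo] --> (1 : R).
Proof.
have p0 n : 0 <= p n by have /andP[] := p01 n.
have pgt0 : \forall n \near \oo, 0 < p n.
  by have := much_less_le p0 ltr01 p_lower; apply: filterS => n [].
apply/cvgrPdist_le => eps eps0; have [M hM] := two_round_bound eps0.
near=> n.
rewrite gnp2_prC opprB addrC subrK ger0_norm.
  rewrite gnp2_prE; apply: hM => //; near: n.
  - exact: upper_density.
  - exact: lower_density.
  - exact: lower_second_density.
by rewrite gnp2_prE; apply: Ex_ge0 => // G1; apply: Ex_ge0.
Unshelve. all: by end_near. Qed.
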